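(* Let $(X,\mathcal{F})$ be a measurable space with a $\sigma$-finite measure $\mu$, and let $\{p(x|\theta):\theta\in\Theta\}$, $\Theta\subset\mathbb{R}^d$, be a family of probability densities with respect to $\mu$. For $z^k=(z_1,\dots,z_k)\in X^k$ write $p(z^k|\theta)=\prod_{i=1}^k p(z_i|\theta)$, and assume a maximum likelihood estimator $\hat\theta(z^k)\in\Theta$ (a maximizer of $\theta\mapsto p(z^k|\theta)$) exists for every $k\in\mathbb{N}$ and every $z^k\in X^k$; for $x^N\in X^N$, $y^M\in X^M$ write $\hat\theta(x^N,y^M)$ for the MLE based on the concatenated sample of size $N+M$. Let $K$ be a compact subset of the interior of $\Theta$ such that $p(z|\theta)>0$ for all $z\in X$, $\theta\in K$, and let $\delta>0$ be such that $K_\delta=\{\tilde\theta\in\Theta:\exists\theta\in K,\ |\theta-\tilde\theta|\le\delta\}$ is contained in the interior of $\Theta$. Assume the following conditions. (A1) There exist a measurable $L:X\to\mathbb{R}_+$ and $\alpha\in[1,\infty]$ such that $|\log p(z|\theta_1)-\log p(z|\theta_2)|\le L(z)|\theta_1-\theta_2|$ for all $z\in X$ and $\theta_1,\theta_2\in K_\delta$, and $\sup_{\theta\in K}\int_X p(z|\theta)L(z)^\alpha\,d\mu(z)<\infty$ (for $\alpha=\infty$ this means $\operatorname{ess\,sup}_z L(z)<\infty$). (A2) With $\beta\ge1$ defined by $1/\alpha+1/\beta=1$: $\lim_{k\to\infty}\sup_{\theta\in K}\int_{X^k}p(z^k|\theta)|\hat\theta(z^k)-\theta|^\beta\,d\mu(z^k)=0$.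 (A3) There exist a measurable $T:X\to\mathbb{R}_+$ and $r\in(1,\infty]$ such that $\sup_{\theta\in K}\{\log p(z|\hat\theta(z))-\log p(z|\theta)\}\le T(z)$ for all $z\in X$ and $\sup_{\theta\in K}\int_X p(z|\theta)T(z)^r\,d\mu(z)<\infty$. (A4) $\lim_{k\to\infty}\sup_{\theta\in K}\left|\int_{X^k}p(z^k|\theta)\log\frac{p(z^k|\hat\theta(z^k))}{p(z^k|\theta)}\,d\mu(z^k)-\frac d2\right|=0$. (A5) For the fixed $N$ there exist constants $C^{N,M}$ not depending on $\theta$ such that $\lim_{M\to\infty}\sup_{\theta\in K}\left|\int_{X^N}p(x^N|\theta)\log\left(\int_{X^M}p(y^M|\hat\theta(x^N,y^M))\,d\mu(y^M)\right)d\mu(x^N)-C^{N,M}\right|=0$. Then, for fixed $N$, $$\lim_{M\to\infty}\sup_{\pi\in\mathcal{P}_K}\left|D^{N,M}_{K,q_{\mathrm{CNML3}}}(\pi)+R^{N,M}_{\mathrm{KL}}(\pi,p_\pi)-\tilde C^{N,M}\right|=0,$$ where $\tilde C^{N,M}=C^{N,M}-d/2$ does not depend on $\pi$.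
   Context: $\mathcal{P}_K$ denotes the set of all probability measures on $\Theta$ whose support is contained in $K$. For $\pi\in\mathcal{P}_K$, $p_\pi(x^k)=\int_\Theta p(x^k|\theta)\,d\pi(\theta)$ and $p_\pi(y^M|x^N)=p_\pi(x^N,y^M)/p_\pi(x^N)$ is the Bayesian predictive density, where $p(x^N,y^M|\theta)=p(x^N|\theta)p(y^M|\theta)$. The CNML3 predictive density is $q_{\mathrm{CNML3}}(y^M|x^N)=\dfrac{p(y^M|\hat\theta(x^N,y^M))}{\int_{X^M}p(z^M|\hat\theta(x^N,z^M))\,d\mu(z^M)}$. For a predictive density $q(y^M|x^N)$, $D^{N,M}_{K,q}(\pi)=\int_{X^N\times X^M}p_\pi(x^N,y^M)\log\frac{p_\pi(x^N,y^M)}{q(y^M|x^N)p_\pi(x^N)}\,d\mu(x^N,y^M)$. The KL risk is $R^{N,M}_{\mathrm{KL}}(\theta,q)=\int_{X^N}p(x^N|\theta)\int_{X^M}p(y^M|\theta)\log\frac{p(y^M|\theta)}{q(y^M|x^N)}\,d\mu(y^M)\,d\mu(x^N)$ and $R^{N,M}_{\mathrm{KL}}(\pi,p_\pi)=\int_\Theta R^{N,M}_{\mathrm{KL}}(\theta,p_\pi)\,d\pi(\theta)$ (the conditional mutual information). $|\cdot|$ is the Euclidean norm. *)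

(* Defs.v *)
From HB Require Import structures.
From mathcomp Require Import all_boot all_order all_algebra.
From mathcomp Require Import all_classical all_reals all_analysis ess_sup_inf.
Unset Printing Implicit Defensive.
Import Order.TTheory GRing.Theory Num.Theory numFieldNormedType.Exports.
Local Open Scope classical_set_scope.
Local Open Scope ring_scope.

Notation Par R n := (g_sigma_algebraType (@open 'rV[R]_n)).

Definition enorm {R : realType} {n : nat} (v : 'rV[R]_n) : R :=
  Num.sqrt (\sum_(i < n) v ord0 i ^+ 2).

Definition pk {R : realType} {n : nat} {X : Type} (p : X -> 'rV[R]_n -> R)
  (k : nat) (z : k.-tuple X) (th : 'rV[R]_n) : R :=
  \prod_(i < k) p (tnth z i) th.

(* muk k is the k-fold product measure mu^k on X^k (k-tuples with the
   product sigma-algebra): it agrees with the product of mu on measurable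
   rectangles (for sigma-finite mu this determines it uniquely). *)
Definition is_product_measure {R : realType} {d : measure_display}
  {X : measurableType d} (mu : {measure set X -> \bar R})
  (muk : forall k, {measure set (k.-tuple X) -> \bar R}) : Prop :=
  forall k (A : 'I_k -> set X), (forall i, measurable (A i)) ->
    muk k [set z | forall i, A i (tnth z i)] = (\prod_(i < k) mu (A i))%E.

Definition tfst {X : Type} (N M : nat) (t : (N + M).-tuple X) : N.-tuple X :=
  [tuple tnth t (lshift M i) | i < N].
Definition tsnd {X : Type} (N M : nat) (t : (N + M).-tuple X) : M.-tuple X :=
  [tuple tnth t (rshift N j) | j < M].

Definition msupport {R : realType} {n : nat}
  (pi : {measure set (Par R n) -> \bar R}) : set 'rV[R]_n :=
  [set th | forall U : set 'rV[R]_n, open U -> U th -> (0 < pi U)%E].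

Definition PK {R : realType} {n : nat} (K : set 'rV[R]_n) :
  set (probability (Par R n) R) :=
  [set pi | msupport pi `<=` K].

Definition Kdelta {R : realType} {n : nat} (Theta K : set 'rV[R]_n) (delta : R)
  : set 'rV[R]_n :=
  [set th' | Theta th' /\ exists2 th, K th & enorm (th - th') <= delta].

Definition conj_exp {R : realType} (a b : \bar R) : Prop :=
  match a, b with
  | a%:E, b%:E => a^-1 + b^-1 = 1
  | +oo%E, b%:E => b = 1
  | a%:E, +oo%E => a = 1
  | _, _ => False
  end.

Definition ppi {R : realType} {n : nat} {X : Type} (p : X -> 'rV[R]_n -> R)
  (pi : probability (Par R n) R) (k : nat) (z : k.-tuple X) : \bar R :=
  (\int[pi]_th (pk p k z th)%:E)%E.

Definition Zcnml3 {R : realType} {n : nat} {d : measure_display}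
  {X : measurableType d} (p : X -> 'rV[R]_n -> R)
  (muk : forall k, {measure set (k.-tuple X) -> \bar R})
  (thetah : forall k, k.-tuple X -> 'rV[R]_n) (N M : nat) (x : N.-tuple X)
  : \bar R :=
  (\int[muk M]_z (pk p M z (thetah (N + M)%N (cat_tuple x z)))%:E)%E.

Definition qcnml3 {R : realType} {n : nat} {d : measure_display}
  {X : measurableType d} (p : X -> 'rV[R]_n -> R)
  (muk : forall k, {measure set (k.-tuple X) -> \bar R})
  (thetah : forall k, k.-tuple X -> 'rV[R]_n) (N M : nat)
  (x : N.-tuple X) (y : M.-tuple X) : \bar R :=
  ((pk p M y (thetah (N + M)%N (cat_tuple x y)))%:E
     * (Zcnml3 p muk thetah N M x)^-1)%E.

Definition Dq {R : realType} {n : nat} {d : measure_display}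
  {X : measurableType d} (p : X -> 'rV[R]_n -> R)
  (muk : forall k, {measure set (k.-tuple X) -> \bar R}) (N M : nat)
  (q : N.-tuple X -> M.-tuple X -> \bar R) (pi : probability (Par R n) R)
  : \bar R :=
  (\int[muk (N + M)%N]_t
     (ppi p pi (N + M)%N t * lne (ppi p pi (N + M)%N t
        * (q (tfst N M t) (tsnd N M t) * ppi p pi N (tfst N M t))^-1)))%E.

Definition RKL {R : realType} {n : nat} {d : measure_display}
  {X : measurableType d} (p : X -> 'rV[R]_n -> R)
  (muk : forall k, {measure set (k.-tuple X) -> \bar R}) (N M : nat)
  (q : N.-tuple X -> M.-tuple X -> \bar R) (th : 'rV[R]_n) : \bar R :=
  (\int[muk N]_x ((pk p N x th)%:E *
     \int[muk M]_y ((pk p M y th)%:E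
        * lne ((pk p M y th)%:E * (q x y)^-1))))%E.

Definition ppred {R : realType} {n : nat} {X : Type} (p : X -> 'rV[R]_n -> R)
  (pi : probability (Par R n) R) (N M : nat) (x : N.-tuple X)
  (y : M.-tuple X) : \bar R :=
  (ppi p pi (N + M)%N (cat_tuple x y) * (ppi p pi N x)^-1)%E.

Definition RKLpi {R : realType} {n : nat} {d : measure_display}
  {X : measurableType d} (p : X -> 'rV[R]_n -> R)
  (muk : forall k, {measure set (k.-tuple X) -> \bar R}) (N M : nat)
  (pi : probability (Par R n) R) : \bar R :=
  (\int[pi]_th RKL p muk N M (ppred p pi N M) th)%E.

(* Main.v *)
Require Import Defs.
From HB Require Import structures.
From mathcomp Require Import all_boot all_order all_algebra.
From mathcomp Require Import all_classical all_reals all_analysis ess_sup_inf.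
From mathcomp Require Import measurable_realfun lra ring.
Import Order.TTheory GRing.Theory Num.Theory numFieldNormedType.Exports.
Local Open Scope classical_set_scope.
Local Open Scope ring_scope.
Set Implicit Arguments.
Unset Strict Implicit.

(** Integrating over [th ~ pi], the predictive density [p_pi] cancels in the sum
    of the two quantities, which becomes the [pi]-average of
      [E_th (- W_{N+M} + G + ln Z)],
    where [W_k = ln p(z^k|MLE) - ln p(z^k|th)] ([mle_gap]) and
    [G = ln p(x^N|MLE) - ln p(x^N|th)] ([block_gain])
    with the MLE of the whole sample [(x^N, y^M)], and [Z] is the normalizer of
    CNML3. By (A4) and (A5) it remains to see that [E_th G] vanishes uniformly on
    [K].  From above: [G] is at most [|MLE - th|] times the sum of the [L (x_i)]
    near [th] and at most the sum of the [T (x_i)] far from it, and truncation of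
    [L] and [T] together with (A2) makes both expectations small.  From below: the
    MLE of [y^M] alone beats the global one on [y^M], so [G >= W_{N+M} - W_M], and
    both terms have the same limit expectation [d/2]. *)

(** The exponents of (A1) and (A2) suggest Hölder's inequality, but [T] has an exponent of its own,
    unrelated to the one in (A2). The bound [x <= c + d * x ^ s] with a small [d] serves both
    functions: the moment condition absorbs the power, and Markov's inequality with (A2) handles the
    constant. For [alpha = 1] there is no power to spare; there the essential supremum in (A2) makes
    the far event null. The cancellation of [p_pi] is only formal until both quantities are known to
    be finite, since a sum of extended real integrals need not be the integral of the sum. The
    log-ratio is therefore kept in two pieces ([h1] and [h2]), each absolutely integrable with a
    bound uniform over [K]. For [h1] this comes from (A1) and the compactness of [K]: likelihoods on
    [K] agree up to a factor depending on the data only, so the mixture is comparable with each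
    component. These bounds may grow with [M], but no limit is taken through them. That [ln Z] is
    integrable is extracted from (A5), and (A3) bounds its negative part. *)

Section null_sets.
Import HBNNSimple.
Context d (T : measurableType d) (R : realType).
Variable m : {measure set T -> \bar R}.
Local Open Scope ereal_scope.

(** As [f] and [g] are arbitrary nonnegative functions, the comparison is made on simple functions:
    one lying below [f] keeps its integral when it is set to 0 on [N], and then it lies below
    [g]. *)
Let nnintegral_negl_le (f g : T -> \bar R) (N : set T) :
  measurable N -> m N = 0 -> (forall x, 0 <= f x) -> (forall x, 0 <= g x) ->
  (forall x, ~ N x -> f x = g x) -> \int[m]_x f x <= \int[m]_x g x.
Proof.
move=> mN N0 f0 g0 fg; rewrite !ge0_integralTE//.
apply: ge_ereal_sup => _ [h /= hf <-].
pose h' := proj_nnsfun h (measurableC mN).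
have hh' : sintegral m h = sintegral m h'.
  rewrite -!integralT_nnsfun; apply: ge0_ae_eq_integral => //.
  - by apply/measurable_EFinP; exact: measurable_funPT.
  - by apply/measurable_EFinP; exact: measurable_funPT.
  - by move=> x _; rewrite lee_fin.
  - by move=> x _; rewrite lee_fin; exact: (@fun_ge0 _ _ h').
  exists N; split => // x /= /not_implyP[_] /=; apply: contra_notP => Nx.
  by rewrite mindicE mem_set// mulr1.
rewrite hh'; apply: ereal_sup_ubound; exists h' => //= x.
rewrite mindicE; have [Nx|Nx] := pselect (N x).
  by rewrite memNset ?mulr0//= => /(_ Nx).
by rewrite mem_set// mulr1 -fg.
Qed.

(* Needed for [th |-> RKL _ _ _ _ _ th], about which nothing is known off [K], and
   for the integrand of [Dq], which is infinite where the normalizer is. *)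
Lemma eq_integral_negl (f g : T -> \bar R) (N : set T) :
  measurable N -> m N = 0 -> (forall x, ~ N x -> f x = g x) ->
  \int[m]_x f x = \int[m]_x g x.
Proof.
move=> mN N0 fg; rewrite (integralE _ _ f) (integralE _ _ g).
have pE x : ~ N x -> f^\+ x = g^\+ x by move=> Nx; rewrite !funeposE fg.
have nE x : ~ N x -> f^\- x = g^\- x by move=> Nx; rewrite !funenegE fg.
by congr (_ - _); apply/eqP; rewrite eq_le !(@nnintegral_negl_le _ _ N)// => x Nx;
  rewrite ?pE ?nE.
Qed.

End null_sets.

(** * Uniform limits written with suprema *)

Section sup_cvg0.
Context {R : realType} {I : Type}.
Variables (A : set I) (F : nat -> I -> \bar R).
Local Open Scope ereal_scope.

Lemma sup_cvg0_near :
  (fun k => ereal_sup [set F k i | i in A]) @ \oo --> 0 ->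
  forall e : R, (0 < e)%R -> \forall k \near \oo, forall i, A i -> F k i <= e%:E.
Proof.
move=> h e e0.
have : \forall k \near \oo, ereal_sup [set F k i | i in A] < e%:E.
  have /h : nbhs (0 : \bar R) [set y | y < e%:E].
    by apply: open_nbhs_nbhs; split; [exact: open_ereal_lt_ereal|rewrite /= lte_fin].
  by [].
apply: filterS => k ke i Ai; apply: (le_trans _ (ltW ke)).
by apply: ereal_sup_ubound; exists i.
Qed.

(** The index set has to be inhabited: over the empty set the supremum is [-oo], which does not tend
    to 0. *)
Lemma near_sup_cvg0 : A !=set0 -> (forall k i, 0 <= F k i) ->
  (forall e : R, (0 < e)%R -> \forall k \near \oo, forall i, A i -> F k i <= e%:E) ->
  (fun k => ereal_sup [set F k i | i in A]) @ \oo --> 0.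
Proof.
move=> [i0 Ai0] F0 h; apply/fine_cvgP.
have sup0 k : 0 <= ereal_sup [set F k i | i in A].
  by apply: (le_trans (F0 k i0)); apply: ereal_sup_ubound; exists i0.
have hs (e : R) : (0 < e)%R ->
    \forall k \near \oo, ereal_sup [set F k i | i in A] <= e%:E.
  move=> e0; apply: filterS (h _ e0) => k hk.
  by apply: ge_ereal_sup => _ [i Ai <-]; exact: hk.
split.
  apply: filterS (hs 1%R ltr01) => k hk.
  by rewrite ge0_fin_numE// (le_lt_trans hk)// ltry.
apply/cvgrPdist_le => e e0; apply: filterS (hs _ e0) => k hk /=.
rewrite sub0r normrN ger0_norm ?fine_ge0//.
rewrite -lee_fin fineK// ge0_fin_numE//; exact: le_lt_trans hk (ltry _).
Qed.

End sup_cvg0.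

(** Second countability: every point off [K] has a null open neighbourhood, and this contains one of
    countably many rational balls around the point. Taking interiors makes the balls open, hence
    Borel. *)
Lemma measure_msupport_setC {R : realType} {n : nat}
    (pi : probability (Par R n) R) (K : set 'rV[R]_n) :
  compact K -> msupport pi `<=` K ->
  measurable (K : set (Par R n)) /\ pi (~` K) = 0%E.
Proof.
move=> cK sK.
have oKC : open (~` K).
  by apply: closed_openC; apply: compact_closed => //; exact: norm_hausdorff.
have mo (U : set 'rV[R]_n) : open U -> measurable (U : set (Par R n)).
  by move=> oU; exact: sub_sigma_algebra.
have mono (U V : set (Par R n)) : measurable U -> measurable V -> U `<=` V ->
    (pi U <= pi V)%E by move=> mU mV; apply: le_measure; rewrite inE.
have mKC : measurable (~` K : set (Par R n)) by exact: mo.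
split; first by rewrite -(setCK K); exact: measurableC.
pose cen (q : 'rV[rat]_n) : 'rV[R]_n := map_mx ratr q.
pose B (w : 'rV[rat]_n * nat) : set 'rV[R]_n := (ball (cen w.1) (w.2.+1%:R^-1))°.
pose S := [set w : 'rV[rat]_n * nat | pi (B w) = 0%E].
have sub : ~` K `<=` \bigcup_(w in S) B w.
  move=> x Kx.
  have /existsNP[U /not_implyP[oU /not_implyP[Ux /negP piU]]] : ~ msupport pi x by move/sK.
  have piU0 : pi U = 0%E by apply/eqP; rewrite eq_le measure_ge0 andbT leNgt.
  have /nbhs_ballP[e /= e0 eU] : nbhs x U by exact: open_nbhs_nbhs.
  (* A ball of radius below [e / 2] that contains [x] stays in [U]. The rational centre is then
     taken within half the radius, so that [x] is an interior point of the ball. *)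
  have [k _ ke] : exists2 k : nat, True & k.+1%:R^-1 < e / 2.
    have := near_infty_natSinv_lt (PosNum (divr_gt0 e0 (ltr0Sn R 1))).
    by move=> [k _ /(_ k (leqnn _)) /= h]; exists k.
  have k0 : 0 < k.+1%:R^-1 :> R by rewrite invr_gt0.
  have [q qx] : exists q : 'rV[rat]_n, forall i,
      `|x ord0 i - ratr (q ord0 i)| < k.+1%:R^-1 / 2.
    have : forall i, exists q : rat, `|x ord0 i - ratr q| < k.+1%:R^-1 / 2.
      move=> i.
      have lt : x ord0 i - k.+1%:R^-1 / 2 < x ord0 i + k.+1%:R^-1 / 2.
        by move: k0; set t := _^-1 => t0; lra.
      have [q /=] := rat_in_itvoo lt.
      rewrite in_itv/= => /andP[q1 q2]; exists q.
      move: q1 q2; rewrite ltr_norml; set t := _^-1 => q1 q2; lra.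
    move=> /choice[q hq]; exists (\row_i q i) => i; rewrite mxE; exact: hq.
  have bx r : k.+1%:R^-1 / 2 <= r -> ball (cen q) r x.
    move=> hr; split; first by apply: lt_le_trans hr; rewrite divr_gt0.
    move=> i j; rewrite (ord1 i) /cen mxE /ball/= distrC.
    exact: lt_le_trans (qx j) hr.
  exists (q, k) => /=; last first.
    rewrite /B/= /interior; apply/nbhs_ballP; exists (k.+1%:R^-1 / 2); rewrite /= ?divr_gt0//.
    move=> z xz; rewrite [X in ball _ X](splitr (k.+1%:R^-1)).
    by apply: ball_triangle xz; exact: bx.
  apply/eqP; rewrite eq_le measure_ge0 andbT -piU0.
  apply: mono; [by apply: mo; exact: open_interior|exact: mo|].
  move=> z /interior_subset/= bz; apply: eU.
  apply: (@le_ball _ _ _ (k.+1%:R^-1 + k.+1%:R^-1)).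
    by move: ke; set t := _^-1 => ke; lra.
  by apply: ball_triangle bz; apply/ball_sym/bx; move: k0; set t := _^-1 => k0; lra.
(* The null balls are reindexed by [nat], as [negligible_bigcup] speaks of sequences; a code of no
   ball, or of a ball outside [S], yields the empty set. *)
pose F k : set (Par R n) :=
  if @unpickle ('rV[rat]_n * nat)%type k is Some w
  then [set z | S w /\ B w z] else set0.
have Fneg k : pi.-negligible (F k).
  rewrite /F; case: unpickle => [w|]; last exact: negligible_set0.
  have [Sw|Sw] := pselect (S w); last first.
    by exists set0; split => // z [/Sw].
  exists (B w); split => //; last by move=> z [].
  by apply: mo; exact: open_interior.
have [N [mN N0 FN]] : pi.-negligible (\bigcup_k F k) by exact: negligible_bigcup.
apply/eqP; rewrite eq_le measure_ge0 andbT -N0; apply: mono => // x /sub[w Sw Bwx].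
by apply: FN; exists (pickle w) => //; rewrite /F pickleK.
Qed.

(** * Product measures on tuples *)

Section sigma_finite_pack.
Context d (T : measurableType d) (R : realType).
Variables (m : {measure set T -> \bar R}) (mfin : sigma_finite setT m).

(** Product measures and Fubini ask for the sigma-finite structure, while for [muk k]
    sigma-finiteness is only a proved fact. Making the proof an argument of the copy gives the
    instances something to attach to. *)
Definition sigma_finite_copy of sigma_finite setT m : set T -> \bar R := m.

HB.instance Definition _ := isMeasure.Build _ _ _ (sigma_finite_copy mfin)
  (measure0 m) (measure_ge0 m) (@measure_semi_sigma_additive _ _ _ m).
HB.instance Definition _ :=
  Measure_isSigmaFinite.Build _ _ _ (sigma_finite_copy mfin) mfin.

Definition sigma_finite_pack : {sigma_finite_measure set T -> \bar R} :=
  sigma_finite_copy mfin.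

End sigma_finite_pack.

Definition rectangle {X : Type} (k : nat) (A : 'I_k -> set X) : set (k.-tuple X) :=
  [set z | forall i, A i (tnth z i)].

Definition catp {X : Type} (N M : nat) (w : N.-tuple X * M.-tuple X) : (N + M).-tuple X :=
  cat_tuple w.1 w.2.

Definition consp {X : Type} (k : nat) (w : X * k.-tuple X) : k.+1.-tuple X :=
  cons_tuple w.1 w.2.

Lemma prode_lty (R : realType) (k : nat) (F : 'I_k -> \bar R) :
  (forall i, (0 <= F i < +oo)%E) -> ((\prod_(i < k) F i)%E < +oo)%E.
Proof.
move=> h.
suff : (0 <= (\prod_(i < k) F i)%E < +oo)%E by case/andP.
apply: (big_ind (fun x => 0 <= x < +oo)%E) => [|x y /andP[x0 xy] /andP[y0 yy]|i _]; last exact: h.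
  by rewrite lee01 ltry.
by rewrite mule_ge0// lte_mul_pinfty// ge0_fin_numE.
Qed.

Section tuple_measure.
Context (R : realType) (d : measure_display) (X : measurableType d).
Variables (mu : {sigma_finite_measure set X -> \bar R})
  (muk : forall k, {measure set (k.-tuple X) -> \bar R}).
Hypothesis muP : is_product_measure mu muk.
Local Open Scope ereal_scope.

Lemma measurable_rectangle k (A : 'I_k -> set X) :
  (forall i, measurable (A i)) -> measurable (rectangle A).
Proof.
move=> mA; rewrite (_ : rectangle A = \bigcap_(i in setT) ((@tnth k X)^~ i @^-1` A i)).
  apply: fin_bigcap_measurable => // i _.
  by rewrite -[X in measurable X]setTI; apply: measurable_tnth.
by apply/seteqP; split => z /= h i; [move=> _|]; apply: h.
Qed.

Lemma muk_rectangle k (A : 'I_k -> set X) : (forall i, measurable (A i)) ->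
  muk k (rectangle A) = \prod_(i < k) mu (A i).
Proof. exact: muP. Qed.

(** The defining generators, preimages under single coordinates, are not stable under intersection;
    rectangles are, as the uniqueness theorem for measures requires. *)
Lemma measurable_tupleE k :
  measurable = <<s [set B : set (k.-tuple X) | exists2 A : 'I_k -> set X,
                      forall i, measurable (A i) & B = rectangle A] >>.
Proof.
apply/seteqP; split.
  apply: smallest_sub; first exact: smallest_sigma_algebra.
  case: k => [|k]; first by rewrite big_ord0.
  rewrite -bigcup_mkord_ord => B [i /= ik [A mA <-]].
  apply: sub_sigma_algebra => /=.
  exists (fun j => if j == inord i then A else setT).
    by move=> j; case: ifPn.
  apply/seteqP; split => z /=; first by move=> [_ h] j; case: eqP => [->|].
  by move=> /(_ (inord i)); rewrite eqxx.
apply: smallest_sub; first exact: sigma_algebra_measurable.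
by move=> _ [A mA ->]; exact: measurable_rectangle.
Qed.

Lemma rectangle_cover k : exists F : (set X)^nat,
  [/\ forall n, measurable (F n), forall n, mu (F n) < +oo,
      \bigcup_n rectangle (fun _ : 'I_k => F n) = setT &
      forall n, muk k (rectangle (fun _ : 'I_k => F n)) < +oo].
Proof.
have /sigma_finiteP[F [FT ndF Ffin]] := sigma_finiteT mu.
exists F; split; [by move=> n; case: (Ffin n)|by move=> n; case: (Ffin n)| |].
  apply/seteqP; split => // z _.
  have /choice[f hf] i : exists n, F n (tnth z i).
    have : setT (tnth z i) by [].
    by rewrite FT => -[n _ ?]; exists n.
  (* The sets [F n] increase, so the largest index serves all coordinates at once. *)
  exists (\max_(i < k) f i)%N => // i.
  have /subsetPset := ndF _ _ (leq_bigmax (F := f) i); exact.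
move=> n; rewrite muk_rectangle; last by move=> _; case: (Ffin n).
by apply: prode_lty => i; rewrite measure_ge0/=; case: (Ffin n).
Qed.

Lemma muk_sigma_finite k : sigma_finite setT (muk k).
Proof.
have [F [mF _ FT Ffin]] := rectangle_cover k.
exists (fun n => rectangle (fun _ : 'I_k => F n)) => // n; split => //.
by apply: measurable_rectangle.
Qed.

Definition mukS k : {sigma_finite_measure set (k.-tuple X) -> \bar R} :=
  sigma_finite_pack (muk_sigma_finite k).

(** The hypothesis on [muk] speaks of rectangles only; agreement there spreads to all measurable
    sets because rectangles form a pi-system containing a countable cover of finite measure. *)
Lemma muk_unique k (m : {measure set (k.-tuple X) -> \bar R}) :
  (forall A : 'I_k -> set X, (forall i, measurable (A i)) ->
     m (rectangle A) = \prod_(i < k) mu (A i)) ->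
  forall B, measurable B -> muk k B = m B.
Proof.
move=> mE; have [F [mF _ FT Ffin]] := rectangle_cover k.
apply: (measure_unique _ _ (measurable_tupleE k) _ _ FT) => //.
- move=> _ _ [A mA ->] [A' mA' ->]; exists (fun i => A i `&` A' i).
    by move=> i; apply: measurableI.
  by apply/seteqP; split => z /=;
    [move=> [h h'] i; split|move=> h; split=> i; case: (h i)].
- by move=> n; exists (fun=> F n).
- by move=> _ [A mA ->]; rewrite mE// muk_rectangle.
Qed.

Lemma measurable_catp N M : measurable_fun setT (@catp X N M).
Proof.
apply/measurable_fun_tnthP => i.
case: (split_ordP i) => j ->.
  rewrite (_ : _ \o _ = (@tnth N X)^~ j \o fst); last first.
    by apply/funext => w /=; rewrite /catp tnth_lshift.
  by apply: measurableT_comp => //; exact: measurable_tnth.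
rewrite (_ : _ \o _ = (@tnth M X)^~ j \o snd); last first.
  by apply/funext => w /=; rewrite /catp tnth_rshift.
by apply: measurableT_comp => //; exact: measurable_tnth.
Qed.

Lemma measurable_consp k : measurable_fun setT (@consp X k).
Proof.
apply/measurable_fun_tnthP => i.
case: (unliftP ord0 i) => [j|] ->.
  rewrite (_ : _ \o _ = (@tnth k X)^~ j \o snd); last first.
    by apply/funext => w /=; rewrite tnthS.
  by apply: measurableT_comp => //; exact: measurable_tnth.
rewrite (_ : _ \o _ = fst)//.
Qed.

Lemma muk_cat N M B : measurable B ->
  muk (N + M) B = pushforward (mukS N \x mukS M) (@catp X N M) B.
Proof.
have mc := @measurable_catp N M.
apply: (muk_unique (m := pushforward (mukS N \x mukS M) (@catp X N M))) => A mA.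
transitivity ((mukS N \x mukS M) (rectangle (fun i => A (lshift M i)) `*`
    rectangle (fun i => A (rshift N i)))).
  apply: (f_equal (mukS N \x mukS M)); apply/seteqP; split => -[x y] /=.
    move=> h; split => i /=.
      by have := h (lshift M i); rewrite /catp tnth_lshift.
    by have := h (rshift N i); rewrite /catp tnth_rshift.
  move=> [hx hy] i; case: (split_ordP i) => j ->.
    by rewrite /catp tnth_lshift.
  by rewrite /catp tnth_rshift.
rewrite product_measure1E; [|exact: measurable_rectangle..].
by rewrite big_split_ord/= -!muk_rectangle.
Qed.

Lemma muk_cons k B : measurable B ->
  muk k.+1 B = pushforward (mu \x mukS k) (@consp X k) B.
Proof.
have mc := @measurable_consp k.
apply: (muk_unique (m := pushforward (mu \x mukS k) (@consp X k))) => A mA.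
transitivity ((mu \x mukS k) (A ord0 `*` rectangle (fun i => A (lift ord0 i)))).
  apply: (f_equal (mu \x mukS k)); apply/seteqP; split => -[x y] /=.
    move=> h; split; first exact: (h ord0).
    by move=> i /=; have := h (lift ord0 i); rewrite tnthS.
  move=> [hx hy] i; case: (unliftP ord0 i) => [j|] -> //.
  by rewrite tnthS; exact: hy.
rewrite product_measure1E//; last exact: measurable_rectangle.
by rewrite big_ord_recl -muk_rectangle.
Qed.

Lemma ge0_integral_catp N M (f : (N + M).-tuple X -> \bar R) :
  measurable_fun setT f -> (forall t, 0 <= f t) ->
  \int[muk (N + M)]_t f t = \int[mukS N \x mukS M]_w f (catp w).
Proof.
move=> mf f0; have mc := @measurable_catp N M.
rewrite (@eq_measure_integral _ _ _ _ (pushforward (mukS N \x mukS M) (@catp X N M))).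
  by rewrite ge0_integral_pushforward.
by move=> A mA _; exact: muk_cat.
Qed.

Lemma ge0_integral_muk_cat N M (f : (N + M).-tuple X -> \bar R) :
  measurable_fun setT f -> (forall t, 0 <= f t) ->
  \int[muk (N + M)]_t f t = \int[muk N]_x \int[muk M]_y f (catp (x, y)).
Proof.
move=> mf f0; rewrite ge0_integral_catp// fubini_tonelli1//.
by apply: measurableT_comp => //; exact: measurable_catp.
Qed.

Lemma ge0_integral_muk_cons k (f : k.+1.-tuple X -> \bar R) :
  measurable_fun setT f -> (forall t, 0 <= f t) ->
  \int[muk k.+1]_t f t = \int[mu]_x \int[muk k]_y f (consp (x, y)).
Proof.
move=> mf f0; have mc := @measurable_consp k.
rewrite (@eq_measure_integral _ _ _ _ (pushforward (mu \x mukS k) (@consp X k))).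
  rewrite ge0_integral_pushforward// fubini_tonelli1//; last by move=> x; exact: f0.
  exact: measurableT_comp.
by move=> A mA _; exact: muk_cons.
Qed.

(** The second conjunct is for the inner integral of [RKL]: a constant factor may cross it where the
    section is integrable. *)
Lemma integral_muk_cat N M (f : (N + M).-tuple X -> \bar R) :
  (muk (N + M)).-integrable setT f ->
  \int[muk (N + M)]_t f t = \int[muk N]_x \int[muk M]_y f (catp (x, y)) /\
  {ae muk N, forall x, (muk M).-integrable setT (fun y => f (catp (x, y)))}.
Proof.
move=> /integrableP[mf iff]; have mc := @measurable_catp N M.
have ic : (mukS N \x mukS M).-integrable setT (f \o @catp X N M).
  apply/integrableP; split; first exact: measurableT_comp.
  by move: iff; rewrite ge0_integral_catp//; exact: measurableT_comp.
split; last exact: ae_integrable1 ic.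
rewrite (integral12_prod_meas1 ic).
rewrite (@eq_measure_integral _ _ _ _ (pushforward (mukS N \x mukS M) (@catp X N M))).
  by rewrite integral_pushforward.
by move=> A mA _; exact: muk_cat.
Qed.

Lemma integral_muk_prod k (g : 'I_k -> X -> R) :
  (forall i, measurable_fun setT (g i)) -> (forall i z, (0 <= g i z)%R) ->
  \int[muk k]_t (\prod_(i < k) g i (tnth t i))%:E =
  \prod_(i < k) \int[mu]_z (g i z)%:E.
Proof.
elim: k g => [|k IH] g mg g0.
  under eq_integral do rewrite big_ord0.
  rewrite big_ord0 integral_cst//= mul1e.
  (* The total mass of [muk 0] is an empty product, hence 1. *)
  have := @muk_rectangle 0 (fun=> setT) (fun=> measurableT).
  by rewrite big_ord0 (_ : rectangle _ = setT)//; apply/seteqP; split => // z _ [].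
have mprod n (h : 'I_n -> X -> R) : (forall i, measurable_fun setT (h i)) ->
    measurable_fun setT (fun t : n.-tuple X => (\prod_(i < n) h i (tnth t i))%R).
  move=> mh; apply: measurable_prod => i _.
  by apply: measurableT_comp => //; exact: measurable_tnth.
rewrite ge0_integral_muk_cons; last 2 first.
- by apply/measurable_EFinP; exact: mprod.
- by move=> t; rewrite lee_fin; apply: prodr_ge0 => i _.
rewrite big_ord_recl -IH//.
transitivity (\int[mu]_x ((g ord0 x)%:E *
    \int[muk k]_t (\prod_(i < k) g (lift ord0 i) (tnth t i))%:E)).
  apply: eq_integral => x _.
  rewrite -ge0_integralZl_EFin//; last 2 first.
  - by move=> y _; rewrite lee_fin; apply: prodr_ge0 => i _.
  - by apply/measurable_EFinP; exact: (mprod _ (fun i => g (lift ord0 i))).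
  apply: eq_integral => y _; rewrite -EFinM big_ord_recl; congr (_ * _)%:E.
  by apply: eq_bigr => i _; rewrite tnthS.
rewrite ge0_integralZr//.
- exact/measurable_EFinP.
- by move=> z _; rewrite lee_fin.
- by apply: integral_ge0 => t _; rewrite lee_fin; apply: prodr_ge0 => i _.
Qed.

End tuple_measure.

(** * Expectations under the model *)

Lemma tfst_catp {X : Type} N M (w : N.-tuple X * M.-tuple X) :
  tfst N M (catp w) = w.1.
Proof. by apply: eq_from_tnth => i; rewrite tnth_mktuple tnth_lshift. Qed.

Lemma tsnd_catp {X : Type} N M (w : N.-tuple X * M.-tuple X) :
  tsnd N M (catp w) = w.2.
Proof. by apply: eq_from_tnth => i; rewrite tnth_mktuple tnth_rshift. Qed.

Lemma catp_tfst_tsnd {X : Type} N M (t : (N + M).-tuple X) :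
  cat_tuple (tfst N M t) (tsnd N M t) = t.
Proof.
apply: eq_from_tnth => i; case: (split_ordP i) => j ->.
  by rewrite tnth_lshift tnth_mktuple.
by rewrite tnth_rshift tnth_mktuple.
Qed.

Lemma measurable_tfst d (X : measurableType d) N M :
  measurable_fun setT (@tfst X N M).
Proof.
apply/measurable_fun_tnthP => i.
rewrite (_ : _ \o _ = (@tnth _ X)^~ (lshift M i)); first exact: measurable_tnth.
by apply/funext => t /=; rewrite tnth_mktuple.
Qed.

Lemma measurable_tsnd d (X : measurableType d) N M :
  measurable_fun setT (@tsnd X N M).
Proof.
apply/measurable_fun_tnthP => i.
rewrite (_ : _ \o _ = (@tnth _ X)^~ (rshift N i)); first exact: measurable_tnth.
by apply/funext => t /=; rewrite tnth_mktuple.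
Qed.

(** * The Euclidean norm on row vectors and its measurability *)

Section enorm.
Context {R : realType} {n : nat}.

Lemma enorm_ge0 (v : 'rV[R]_n) : 0 <= enorm v.
Proof. exact: sqrtr_ge0. Qed.

Lemma enormN (v : 'rV[R]_n) : enorm (- v) = enorm v.
Proof. by congr Num.sqrt; apply: eq_bigr => i _; rewrite mxE sqrrN. Qed.

Lemma enormB (v w : 'rV[R]_n) : enorm (v - w) = enorm (w - v).
Proof. by rewrite -enormN opprB. Qed.

(** The ambient norm on matrices is the maximum norm, whence the factor [n%:R]. *)
Lemma enorm_le (v : 'rV[R]_n) (B : R) : 0 <= B -> `|v| <= B -> enorm v <= Num.sqrt (n%:R * B ^+ 2).
Proof.
move=> B0 vB; rewrite ler_sqrt ?mulr_ge0 ?sqr_ge0//.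
rewrite -[n in n%:R]card_ord -sumr_const big_distrl/=; apply: ler_sum => i _.
rewrite mul1r -real_normK ?num_real//; apply: lerXn2r; rewrite ?nnegrE//.
apply: (le_trans _ vB); rewrite [leRHS](_ : _ = mx_norm v)// mx_normrE.
exact: (le_bigmax_cond _ (fun ij : 'I_1 * 'I_n => `|v ij.1 ij.2|) (isT : xpredT (ord0, i))).
Qed.

Lemma measurable_coord i : measurable_fun setT (fun v : Par R n => (v : 'rV[R]_n) ord0 i).
Proof.
apply: (measurability _ (RGenOpens.measurableE R)) => _ [_ [a [b ->]] <-].
rewrite setTI; apply: sub_sigma_algebra => /=.
have := (@coord_continuous R 1 n ord0 i) => /continuousP; apply; exact: interval_open.
Qed.

Lemma measurable_enormB (v : 'rV[R]_n) :
  measurable_fun setT (fun w : Par R n => enorm ((w : 'rV[R]_n) - v)).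
Proof.
apply: (@measurableT_comp _ _ _ _ _ _ (fun x : R => Num.sqrt x) _
    (fun w : Par R n => \sum_(i < n) ((w : 'rV[R]_n) - v) ord0 i ^+ 2)).
  by apply: continuous_measurable_fun; exact: sqrt_continuous.
apply: measurable_sum => i; under eq_fun do rewrite !mxE.
apply: measurable_funX; apply: measurable_funB => //; exact: measurable_coord.
Qed.

End enorm.

Section model.
Context (R : realType) (dim : nat) (d : measure_display) (X : measurableType d).
Variables (mu : {sigma_finite_measure set X -> \bar R})
  (muk : forall k, {measure set (k.-tuple X) -> \bar R})
  (p : X -> 'rV[R]_dim -> R).
Hypothesis muP : is_product_measure mu muk.
Hypothesis mp : measurable_fun setT (fun w : X * Par R dim => p w.1 w.2).
Local Open Scope ereal_scope.

Lemma measurable_pk_comp d' (S : measurableType d') k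
    (f : S -> k.-tuple X) (g : S -> Par R dim) :
  measurable_fun setT f -> measurable_fun setT g ->
  measurable_fun setT (fun s => pk p k (f s) (g s)).
Proof.
move=> mf mg; apply: measurable_prod => i _.
apply: (measurableT_comp mp (g := fun s => (tnth (f s) i, g s))).
apply: measurable_fun_pair => //.
by apply: (measurableT_comp (measurable_tnth i)).
Qed.

Lemma measurable_pk k (th : Par R dim) : measurable_fun setT (fun t => pk p k t th).
Proof. by apply: measurable_pk_comp. Qed.

Lemma measurable_p (th : Par R dim) : measurable_fun setT (fun z => p z th).
Proof.
by apply: (measurableT_comp mp (g := fun z => (z, th))); exact: measurable_fun_pair.
Qed.

Lemma pk_cat N M (t : (N + M).-tuple X) th :
  pk p (N + M) t th = (pk p N (tfst N M t) th * pk p M (tsnd N M t) th)%R.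
Proof.
by rewrite /pk big_split_ord; congr (_ * _)%R; apply: eq_bigr => i _; rewrite tnth_mktuple.
Qed.

Lemma pk_catp N M (x : N.-tuple X) (y : M.-tuple X) th :
  pk p (N + M) (catp (x, y)) th = (pk p N x th * pk p M y th)%R.
Proof. by rewrite pk_cat tfst_catp tsnd_catp. Qed.

(** The integrand is formed in [R] before the coercion, which keeps the conventions for infinite
    products and sums out of the calculus of expectations. *)
Definition Ek k (th : 'rV[R]_dim) (f : k.-tuple X -> R) : \bar R :=
  \int[muk k]_t (pk p k t th * f t)%:E.

Variable th : 'rV[R]_dim.
Hypothesis pgt0 : forall z, (0 < p z th)%R.
Hypothesis p1 : \int[mu]_z (p z th)%:E = 1.

Lemma pk_gt0 k t : (0 < pk p k t th)%R.
Proof. by apply: prodr_gt0 => i _; exact: pgt0. Qed.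

Lemma measurable_Ek k (f : k.-tuple X -> R) : measurable_fun setT f ->
  measurable_fun setT (fun t => (pk p k t th * f t)%:E).
Proof.
by move=> mf; apply/measurable_EFinP/measurable_funM => //; exact: measurable_pk.
Qed.

Lemma Ek_ge0 k (f : k.-tuple X -> R) : (forall t, 0 <= f t)%R -> 0 <= Ek th f.
Proof.
move=> f0; apply: integral_ge0 => t _.
by rewrite lee_fin mulr_ge0// ltW// pk_gt0.
Qed.

Lemma Ek_le k (f g : k.-tuple X -> R) : measurable_fun setT f -> measurable_fun setT g ->
  (forall t, 0 <= f t)%R -> (forall t, f t <= g t)%R -> Ek th f <= Ek th g.
Proof.
move=> mf mg f0 fg; apply: ge0_le_integral => //.
- by move=> t _; rewrite lee_fin mulr_ge0// ltW// pk_gt0.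
- exact: measurable_Ek.
- exact: measurable_Ek.
- by move=> t _; rewrite lee_fin ler_wpM2l// ltW// pk_gt0.
Qed.

Lemma EkD k (f g : k.-tuple X -> R) : measurable_fun setT f -> measurable_fun setT g ->
  (forall t, 0 <= f t)%R -> (forall t, 0 <= g t)%R ->
  Ek th (fun t => f t + g t)%R = Ek th f + Ek th g.
Proof.
move=> mf mg f0 g0; rewrite /Ek -ge0_integralD//.
- by apply: eq_integral => t _; rewrite mulrDr EFinD.
- by move=> t _; rewrite lee_fin mulr_ge0// ltW// pk_gt0.
- exact: measurable_Ek.
- by move=> t _; rewrite lee_fin mulr_ge0// ltW// pk_gt0.
- exact: measurable_Ek.
Qed.

Lemma EkZ k (c : R) (f : k.-tuple X -> R) : measurable_fun setT f ->
  (forall t, 0 <= f t)%R -> (0 <= c)%R ->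
  Ek th (fun t => c * f t)%R = c%:E * Ek th f.
Proof.
move=> mf f0 c0; rewrite /Ek -ge0_integralZl_EFin//.
- by apply: eq_integral => t _; rewrite -EFinM mulrCA.
- by move=> t _; rewrite lee_fin mulr_ge0// ltW// pk_gt0.
- exact: measurable_Ek.
Qed.

Lemma Ek_sum k n (f : 'I_n -> k.-tuple X -> R) :
  (forall i, measurable_fun setT (f i)) -> (forall i t, 0 <= f i t)%R ->
  Ek th (fun t => \sum_(i < n) f i t)%R = \sum_(i < n) Ek th (f i).
Proof.
move=> mf f0; rewrite /Ek -ge0_integral_sum//.
- by apply: eq_integral => t _; rewrite mulr_sumr sumEFin.
- by move=> i; exact: measurable_Ek.
- by move=> i t _; rewrite lee_fin mulr_ge0// ltW// pk_gt0.
Qed.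

(** The integrand is again a product over the coordinates; away from [i] each factor is the density
    itself and integrates to 1. *)
Lemma Ek_coord k (i : 'I_k) (f : X -> R) : measurable_fun setT f ->
  (forall z, 0 <= f z)%R ->
  Ek th (fun t : k.-tuple X => f (tnth t i)) = \int[mu]_z (p z th * f z)%:E.
Proof.
move=> mf f0.
pose g (j : 'I_k) (z : X) := (p z th * (if j == i then f z else 1))%R.
transitivity (\int[muk k]_t (\prod_(j < k) g j (tnth t j))%:E).
  apply: eq_integral => t _; congr EFin; rewrite /g big_split/=; congr (_ * _)%R.
  rewrite (bigD1 i)//= eqxx big1 ?mulr1// => j ji.
  by rewrite (negPf ji).
rewrite (integral_muk_prod muP); last 2 first.
- move=> j; apply: measurable_funM; first exact: measurable_p.
  by case: (j == i).
- by move=> j z; rewrite mulr_ge0//; [exact/ltW|case: ifP].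
rewrite (bigD1 i)//= big1 ?mule1; last first.
  move=> j ji; rewrite -p1; apply: eq_integral => z _.
  by rewrite /g (negPf ji) mulr1.
by apply: eq_integral => z _; rewrite /g eqxx.
Qed.

Lemma integral_pk k : \int[muk k]_t (pk p k t th)%:E = 1.
Proof.
rewrite (integral_muk_prod muP (g := fun _ z => p z th)).
- by rewrite big1.
- by move=> _; exact: measurable_p.
- by move=> _ z; exact/ltW.
Qed.

Lemma Ek_one k : Ek th (fun _ : k.-tuple X => 1%R) = 1.
Proof. by rewrite -(integral_pk k); apply: eq_integral => t _; rewrite mulr1. Qed.

Lemma Ek_cat N M (f : (N + M).-tuple X -> R) : measurable_fun setT f ->
  (forall t, 0 <= f t)%R ->
  Ek th f = \int[muk N]_x \int[muk M]_y
    ((pk p N x th)%:E * (pk p M y th * f (catp (x, y)))%:E).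
Proof.
move=> mf f0; rewrite /Ek (ge0_integral_muk_cat muP); last 2 first.
- exact: measurable_Ek.
- by move=> t; rewrite lee_fin mulr_ge0// ltW// pk_gt0.
apply: eq_integral => x _; apply: eq_integral => y _.
by rewrite pk_catp -EFinM mulrA.
Qed.

Lemma Ek_tfst N M (f : N.-tuple X -> R) : measurable_fun setT f ->
  (forall t, 0 <= f t)%R -> Ek th (fun t => f (tfst N M t)) = Ek th f.
Proof.
move=> mf f0; rewrite Ek_cat//; last first.
  by apply: (measurableT_comp mf); exact: measurable_tfst.
apply: eq_integral => x _.
transitivity (\int[muk M]_y ((pk p N x th * f x)%:E * (pk p M y th * 1)%:E)).
  apply: eq_integral => y _; rewrite -!EFinM tfst_catp/= mulr1 -!mulrA.
  by rewrite (mulrC (f x)).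
rewrite ge0_integralZl_EFin//.
- by have := Ek_one M; rewrite /Ek => ->; rewrite mule1.
- by move=> y _; rewrite mulr1 lee_fin ltW// pk_gt0.
- exact: (@measurable_Ek _ (fun=> 1%R)).
- by rewrite mulr_ge0// ltW// pk_gt0.
Qed.

Lemma Ek_tsnd N M (f : M.-tuple X -> R) : measurable_fun setT f ->
  (forall t, 0 <= f t)%R -> Ek th (fun t => f (tsnd N M t)) = Ek th f.
Proof.
move=> mf f0; rewrite Ek_cat//; last first.
  by apply: (measurableT_comp mf); exact: measurable_tsnd.
transitivity (\int[muk N]_x ((pk p N x th)%:E * Ek th f)).
  apply: eq_integral => x _; rewrite -ge0_integralZl_EFin//.
  - by apply: eq_integral => y _; rewrite tsnd_catp.
  - by move=> y _; rewrite lee_fin mulr_ge0// ltW// pk_gt0.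
  - exact: measurable_Ek.
  - by rewrite ltW// pk_gt0.
rewrite ge0_integralZr//.
- by rewrite integral_pk mul1e.
- by apply/measurable_EFinP; exact: measurable_pk.
- by move=> y _; rewrite lee_fin ltW// pk_gt0.
- exact: Ek_ge0.
Qed.

End model.

(** * Deviations of the estimator *)

(* [c] solves [d * c `^ (s - 1) = 1]. *)
Lemma powR_dominates (R : realType) (d s : R) : 0 < d -> 1 < s ->
  exists2 c : R, 0 <= c & forall x : R, 0 <= x -> x <= c + d * x `^ s.
Proof.
move=> d0 s1; have s10 : 0 < s - 1 by rewrite subr_gt0.
exists (d^-1 `^ (s - 1)^-1); first exact: powR_ge0.
move=> x x0; have [xc|cx] := leP x (d^-1 `^ (s - 1)^-1).
  by apply: (le_trans xc); rewrite lerDl mulr_ge0 ?powR_ge0// ltW.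
have {}x0 : 0 < x by apply: le_lt_trans cx; exact: powR_ge0.
apply: (@le_trans _ _ (d * x `^ s)); last by rewrite lerDr powR_ge0.
have -> : s = 1 + (s - 1) by rewrite addrC subrK.
rewrite powRD ?(gt_eqF x0) ?implybT//.
rewrite (powRr1 (ltW x0)) mulrCA ler_pMr// -ler_pdivrMl// mulr1.
have -> : d^-1 = (d^-1 `^ (s - 1)^-1) `^ (s - 1).
  by rewrite -powRrM mulVf ?gt_eqF// powRr1// invr_ge0 ltW.
by apply: ge0_ler_powR; rewrite ?nnegrE ?powR_ge0// ltW.
Qed.

Lemma le_1D_powR (R : realType) (x s : R) : 0 <= x -> 1 <= s -> x <= 1 + x `^ s.
Proof.
move=> x0 s1; have [x1|x1] := leP x 1; first by rewrite ler_wpDr// powR_ge0.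
rewrite ler_wpDl// -[leLHS]powRr1//; exact: ler_powR (ltW x1) _ _ s1.
Qed.

Section tails.
Context (R : realType) (dim : nat) (d : measure_display) (X : measurableType d).
Variables (mu : {sigma_finite_measure set X -> \bar R})
  (muk : forall k, {measure set (k.-tuple X) -> \bar R})
  (p : X -> 'rV[R]_dim -> R) (K : set 'rV[R]_dim)
  (thetah : forall k, k.-tuple X -> 'rV[R]_dim).
Arguments thetah : clear implicits.
Hypothesis muP : is_product_measure mu muk.
Hypothesis mp : measurable_fun setT (fun w : X * Par R dim => p w.1 w.2).
Hypothesis mth : forall k, measurable_fun setT (thetah k : k.-tuple X -> Par R dim).
Hypothesis Kp : forall th, K th -> forall z, 0 < p z th.
Hypothesis K1 : forall th, K th -> (\int[mu]_z (p z th)%:E = 1)%E.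

Definition far k (th : 'rV[R]_dim) (eta : R) (t : k.-tuple X) : R :=
  if eta < enorm (thetah k t - th) then 1 else 0.

Lemma far_ge0 k th eta t : 0 <= @far k th eta t.
Proof. by rewrite /far; case: ifP. Qed.

Lemma measurable_err k th : measurable_fun setT (fun t => enorm (thetah k t - th)).
Proof. apply: (@measurableT_comp _ _ _ _ _ _
  (fun w : Par R dim => enorm ((w : 'rV[R]_dim) - th)) _ (thetah k)); [exact: measurable_enormB|exact: mth]. Qed.

Lemma measurable_far k th eta : measurable_fun setT (@far k th eta).
Proof.
apply: measurable_fun_ifT => //; apply: measurable_fun_ltr => //; exact: measurable_err.
Qed.

(** The share of the far event in the expectation of [f] at one observation. Uniformity in [i] is
    asked for because a sample of size [N + M] will be read at its first [N] places. *)
Definition tail (f : X -> R) := forall eta e : R, 0 < eta -> 0 < e ->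
  \forall k \near \oo, forall th, K th -> forall i : 'I_k,
    (Ek muk p th (fun t => f (tnth t i) * far th eta t)%R <= e%:E)%E.

Definition moment_le (f : X -> R) (s S : R) := forall th, K th ->
  (\int[mu]_z (p z th * f z `^ s)%:E <= S%:E)%E.

Let mtnth k (i : 'I_k) (f : X -> R) : measurable_fun setT f ->
  measurable_fun setT (fun t : k.-tuple X => f (tnth t i)).
Proof. by move=> mf; apply: (measurableT_comp mf); exact: measurable_tnth. Qed.

(** On the far event [f] is at most [c + dd * f ^ s]. The power costs at most [dd * S], which is
    small by the choice of [dd]; the constant is paid by Markov's inequality, as the far event has
    indicator at most [(enorm (thetah k t - th) / eta) ^ b]. The exponents [s] and [b] are
    unrelated, so [L] and [T] are treated alike. *)
Lemma tail_moment (f : X -> R) (s S b : R) : measurable_fun setT f ->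
  (forall z, 0 <= f z) -> 1 < s -> 0 <= S -> moment_le f s S -> 0 < b ->
  (forall e : R, 0 < e -> \forall k \near \oo, forall th, K th ->
    (Ek muk p th (fun t => enorm (thetah k t - th) `^ b)%R <= e%:E)%E) -> tail f.
Proof.
move=> mf f0 s1 S0 fS b0 Eu eta e eta0 e0.
(* Each of the two terms gets half of [e]; the [+ 1] keeps the thresholds positive when [S] or [C]
   vanishes. *)
have d0 : 0 < e / 2 / (S + 1) by rewrite divr_gt0 ?divr_gt0// ltr_wpDl.
have [c c0 fc] := powR_dominates d0 s1.
set dd := e / 2 / (S + 1) in d0 fc.
have eb0 : 0 < eta `^ b by rewrite powR_gt0.
pose C := c / eta `^ b.
have C0 : 0 <= C by rewrite divr_ge0// ltW.
have h0 : 0 < e / 2 / (C + 1) by rewrite divr_gt0 ?divr_gt0// ltr_wpDl.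
apply: filterS (Eu _ h0) => k hk th Kth i.
have mu_ : measurable_fun setT (fun t : k.-tuple X => enorm (thetah k t - th) `^ b).
  by apply: (measurableT_comp (measurable_powR b)); exact: measurable_err.
have mfs : measurable_fun setT (fun z => f z `^ s).
  exact: (measurableT_comp (measurable_powR s)).
have mfi := mtnth i mfs.
apply: (@le_trans _ _ (Ek muk p th
    (fun t => C * enorm (thetah k t - th) `^ b + dd * f (tnth t i) `^ s)%R)).
  apply: (Ek_le muk mp (Kp Kth)).
  - by apply: measurable_funM; [exact: mtnth|exact: measurable_far].
  - by apply: measurable_funD; apply: measurable_funM.
  - by move=> t; rewrite mulr_ge0// far_ge0.
  move=> t; rewrite /far; case: ifPn => u; last first.
    by rewrite mulr0 addr_ge0// mulr_ge0 ?powR_ge0// ltW.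
  rewrite mulr1; apply: (le_trans (fc _ (f0 _))); rewrite lerD2r.
  rewrite /C -mulrA ler_peMr// ler_pdivlMl// mulr1.
  apply: ge0_ler_powR; rewrite ?nnegrE ?enorm_ge0//; exact: ltW.
rewrite (EkD muk mp (Kp Kth)); [|exact: measurable_funM|exact: measurable_funM| |]; last 2 first.
- by move=> t; rewrite mulr_ge0// powR_ge0.
- by move=> t; rewrite mulr_ge0 ?powR_ge0// ltW.
rewrite (EkZ muk mp (Kp Kth))//; last by move=> t; exact: powR_ge0.
rewrite (EkZ muk mp (Kp Kth))//; [|by move=> t; exact: powR_ge0|exact: ltW].
rewrite (Ek_coord muP mp (Kp Kth) (K1 Kth) i mfs); last first.
  by move=> z; exact: powR_ge0.
apply: (@le_trans _ _ (C%:E * (e / 2 / (C + 1))%:E + dd%:E * S%:E)%E).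
  apply: leeD; apply: lee_wpmul2l; rewrite ?lee_fin//; [exact: hk|exact: ltW|exact: fS].
rewrite -!EFinM -EFinD lee_fin [leRHS]splitr; apply: lerD.
  by rewrite mulrCA ler_piMr ?ltW ?divr_gt0// ltr_pdivrMr ?ltr_wpDl// mul1r ltrDl.
rewrite /dd mulrAC ler_pdivrMr ?ltr_wpDl//.
by rewrite ler_pM2l ?divr_gt0// lerDl.
Qed.

(** Once the essential supremum of the error is at most [eta], the far event is null and the
    expectation is exactly 0, however large [f] is. *)
Lemma tail_ess_sup (f : X -> R) : measurable_fun setT f -> (forall z, 0 <= f z) ->
  (forall e : R, 0 < e -> \forall k \near \oo, forall th, K th ->
    (ess_sup (muk k) (fun z => (enorm (thetah k z - th))%:E) <= e%:E)%E) -> tail f.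
Proof.
move=> mf f0 Eu eta e eta0 e0; apply: filterS (Eu _ eta0) => k hk th Kth i.
have {}hk := hk _ Kth.
rewrite [leLHS](_ : _ = 0%E); first by rewrite lee_fin ltW.
rewrite /Ek -[RHS](@integral0 _ _ _ (muk k) setT).
apply: ae_eq_integral => //.
  apply: (measurable_Ek mp).
  by apply: measurable_funM; [exact: mtnth|exact: measurable_far].
move/ess_supP : hk; apply: filterS => t + _ /=.
by rewrite lee_fin /far ltNge => ->; rewrite !mulr0.
Qed.

Lemma moment_ereal_sup (f : X -> R) (s : R) :
  (ereal_sup [set (\int[mu]_z (p z th * f z `^ s)%:E)%E | th in K] < +oo)%E ->
  exists2 S, 0 <= S & moment_le f s S.
Proof.
(* The maximum with 0 turns a supremum below [+oo] into a finite nonnegative number, also when it is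
   [-oo]. *)
set E := (X in (X < _)%E) => Eoo; exists (fine (Order.max 0%E E)).
  by rewrite fine_ge0// le_max lexx.
move=> th Kth; rewrite fineK; last first.
  by rewrite ge0_fin_numE ?gt_max ?ltry// le_max lexx.
by rewrite le_max; apply/orP; right; apply: ereal_sup_ubound; exists th.
Qed.

(** An essentially bounded function has all moments; 2 is an arbitrary exponent above 1, as
    [tail_moment] asks. *)
Lemma moment_ess_sup (f : X -> R) : measurable_fun setT f -> (forall z, 0 <= f z) ->
  (ess_sup mu (EFin \o f) < +oo)%E -> exists2 S, 0 <= S & moment_le f 2 S.
Proof.
move=> mf f0; set E := (X in (X < _)%E) => Eoo.
pose c := fine (Order.max 0%E E).
have c0 : 0 <= c by rewrite fine_ge0// le_max lexx.
have fc : {ae mu, forall z, f z <= c}.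
  have /ess_supP : (ess_sup mu (EFin \o f) <= c%:E)%E.
    rewrite fineK ?le_max ?lexx ?orbT//.
    by rewrite ge0_fin_numE ?gt_max ?ltry// le_max lexx.
  by apply: filterS => z; rewrite lee_fin.
exists (c `^ 2); first exact: powR_ge0.
move=> th Kth.
have mpth := measurable_p mp th.
apply: (@le_trans _ _ (\int[mu]_z (p z th * c `^ 2)%:E)%E).
  apply: ae_ge0_le_integral => //.
  - by move=> z _; rewrite lee_fin mulr_ge0 ?powR_ge0// ltW// Kp.
  - apply/measurable_EFinP/measurable_funM => //.
    exact: (measurableT_comp (measurable_powR 2)).
  - by move=> z _; rewrite lee_fin mulr_ge0 ?powR_ge0// ltW// Kp.
  - by apply/measurable_EFinP/measurable_funM.
  apply: filterS fc => z fz _; rewrite lee_fin ler_wpM2l//; first by rewrite ltW// Kp.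
  by apply: ge0_ler_powR; rewrite ?nnegrE.
under eq_integral do rewrite EFinM.
rewrite ge0_integralZr//.
- by rewrite K1// mul1e.
- exact/measurable_EFinP.
- by move=> z _; rewrite lee_fin ltW// Kp.
- by rewrite lee_fin powR_ge0.
Qed.

Lemma moment_first (f : X -> R) (s S : R) : measurable_fun setT f ->
  (forall z, 0 <= f z) -> 1 <= s -> moment_le f s S ->
  forall th, K th -> (\int[mu]_z (p z th * f z)%:E <= (1 + S)%:E)%E.
Proof.
move=> mf f0 s1 fS th Kth; have mpth := measurable_p mp th.
have mfs : measurable_fun setT (fun z => f z `^ s).
  exact: (measurableT_comp (measurable_powR s)).
have p0 z : 0 <= p z th by rewrite ltW// Kp.
apply: (@le_trans _ _ (\int[mu]_z ((p z th)%:E + (p z th * f z `^ s)%:E))%E).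
  apply: ge0_le_integral => //.
  - by move=> z _; rewrite lee_fin mulr_ge0.
  - exact/measurable_EFinP/measurable_funM.
  - by apply: emeasurable_funD; apply/measurable_EFinP => //; exact: measurable_funM.
  move=> z _; rewrite -EFinD lee_fin -[X in X + _]mulr1 -mulrDr ler_wpM2l//.
  exact: le_1D_powR.
rewrite ge0_integralD//.
- by rewrite K1// EFinD leeD2l// fS.
- by move=> z _; rewrite lee_fin.
- exact/measurable_EFinP.
- by move=> z _; rewrite lee_fin mulr_ge0// powR_ge0.
- exact/measurable_EFinP/measurable_funM.
Qed.

End tails.

(** * Pointwise likelihood bounds *)

Lemma lne_ratio (R : realType) (a b : R) : 0 < a -> 0 < b ->
  lne (a%:E * (b%:E)^-1)%E = (ln a - ln b)%:E.
Proof.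
move=> a0 b0; rewrite inver gt_eqF// -EFinM lne_EFin ?divr_gt0//.
by rewrite ln_div// posrE.
Qed.

Section pointwise.
Context (R : realType) (dim : nat) (d : measure_display) (X : measurableType d).
Variables (p : X -> 'rV[R]_dim -> R) (Theta K : set 'rV[R]_dim)
  (thetah : forall k, k.-tuple X -> 'rV[R]_dim) (delta : R) (L T : X -> R).
Arguments thetah : clear implicits.
Hypothesis p_ge0 : forall th, Theta th -> forall z, 0 <= p z th.
Hypothesis mle : forall k (z : k.-tuple X), Theta (thetah k z) /\
     forall th, Theta th -> pk p k z th <= pk p k z (thetah k z).
Hypothesis KT : K `<=` Theta.
Hypothesis Kp : forall th, K th -> forall z, 0 < p z th.
Hypothesis K0 : K !=set0.
Hypothesis delta0 : 0 < delta.
Hypothesis L0 : forall z, 0 <= L z.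
Hypothesis T0 : forall z, 0 <= T z.
Hypothesis lip : forall z th1 th2, Kdelta Theta K delta th1 -> Kdelta Theta K delta th2 ->
     0 < p z th1 /\ 0 < p z th2 /\
     `|ln (p z th1) - ln (p z th2)| <= L z * enorm (th1 - th2).
Hypothesis HT : forall z th, K th ->
     ln (p z (thetah 1%N [tuple z])) - ln (p z th) <= T z.

Lemma ln_pk k (t : k.-tuple X) th : (forall i, 0 < p (tnth t i) th) ->
  ln (pk p k t th) = \sum_(i < k) ln (p (tnth t i) th).
Proof.
move=> h; rewrite /pk.
suff : 0 < \prod_(i < k) p (tnth t i) th /\
    ln (\prod_(i < k) p (tnth t i) th) = \sum_(i < k) ln (p (tnth t i) th) by case.
apply: (big_ind2 (fun a b => 0 < a /\ ln a = b)) => [|a a' b b' [a0 <-] [b0 <-]|i _].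
- by rewrite ltr01 ln1.
- by rewrite mulr_gt0// lnM ?posrE.
- by split.
Qed.

Lemma subset_Kdelta : K `<=` Kdelta Theta K delta.
Proof.
move=> th Kth; split; first exact: KT.
exists th => //; rewrite subrr /enorm big1 ?sqrtr0 ?ltW// => i _.
by rewrite mxE expr0n.
Qed.

(** The density may vanish off [K], but the maximum is at least the positive value at a point of
    [K]. *)
Lemma pk_mle_gt0 k t : 0 < pk p k t (thetah k t).
Proof.
have [th Kth] := K0; apply: (@lt_le_trans _ _ (pk p k t th)).
  by apply: pk_gt0; exact: Kp.
by apply: (mle t).2; exact: KT.
Qed.

Lemma p_mle_gt0 k (t : k.-tuple X) i : 0 < p (tnth t i) (thetah k t).
Proof.
rewrite lt_neqAle p_ge0 ?andbT; last exact: (mle t).1.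
apply/eqP => pz; have := pk_mle_gt0 t.
by rewrite /pk (bigD1 i)//= -pz mul0r ltxx.
Qed.

Lemma pk_tfst_mle_gt0 N M (t : (N + M).-tuple X) :
  0 < pk p N (tfst N M t) (thetah (N + M)%N t).
Proof. by apply: prodr_gt0 => i _; rewrite tnth_mktuple p_mle_gt0. Qed.

Lemma pk_tsnd_mle_gt0 N M (t : (N + M).-tuple X) :
  0 < pk p M (tsnd N M t) (thetah (N + M)%N t).
Proof. by apply: prodr_gt0 => i _; rewrite tnth_mktuple p_mle_gt0. Qed.

Lemma ln_pk_cat N M (t : (N + M).-tuple X) th :
  0 < pk p N (tfst N M t) th -> 0 < pk p M (tsnd N M t) th ->
  ln (pk p (N + M) t th) = ln (pk p N (tfst N M t) th) + ln (pk p M (tsnd N M t) th).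
Proof. by move=> h1 h2; rewrite pk_cat lnM ?posrE. Qed.

Definition mle_gap k (th : 'rV[R]_dim) (t : k.-tuple X) : R :=
  ln (pk p k t (thetah k t)) - ln (pk p k t th).

Lemma mle_gap_ge0 k th t : K th -> 0 <= @mle_gap k th t.
Proof.
move=> Kth; rewrite subr_ge0 ler_ln ?posrE ?pk_mle_gt0//.
  by apply: (mle t).2; exact: KT.
by apply: pk_gt0; exact: Kp.
Qed.

(** The map [e] selects the observations: [id] for a whole sample, [lshift M] for its first
    block. *)
Definition sumc N k (e : 'I_N -> 'I_k) (f : X -> R) (t : k.-tuple X) : R :=
  \sum_(i < N) f (tnth t (e i)).

(** Term by term: on a single observation the joint estimator does no better than the estimator
    based on that observation alone, to which [HT] applies. *)
Lemma mle_gap_le k th (t : k.-tuple X) : K th -> mle_gap th t <= sumc id T t.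
Proof.
move=> Kth; rewrite /mle_gap !ln_pk; [|by move=> i; exact: Kp|by move=> i; exact: p_mle_gt0].
rewrite -sumrB; apply: ler_sum => i _; apply: le_trans (HT _ Kth).
rewrite lerD2r ler_ln ?posrE ?p_mle_gt0//.
  have := (mle [tuple tnth t i]).2 _ (mle t).1.
  by rewrite /pk !big_ord_recl !big_ord0 !mulr1.
have := pk_mle_gt0 [tuple tnth t i].
by rewrite /pk !big_ord_recl !big_ord0 !mulr1.
Qed.

Definition block_gain N M (th : 'rV[R]_dim) (t : (N + M).-tuple X) : R :=
  ln (pk p N (tfst N M t) (thetah (N + M)%N t)) - ln (pk p N (tfst N M t) th).

(** One summand for each range of the distance from the estimator to [th]: up to [eta] and from
    [eta] to [delta] the Lipschitz bound applies, beyond [delta] only [T] is available. *)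
Definition block_gain_ub N M (eta : R) (th : 'rV[R]_dim) (t : (N + M).-tuple X) : R :=
  \sum_(i < N) (eta * L (tnth t (lshift M i)) +
    (delta * (L (tnth t (lshift M i)) * far thetah th eta t) +
     T (tnth t (lshift M i)) * far thetah th eta t)).

Lemma block_gain_le N M eta th (t : (N + M).-tuple X) : K th -> 0 <= eta -> eta <= delta ->
  block_gain th t <= block_gain_ub eta th t.
Proof.
move=> Kth eta0 etad; rewrite /block_gain !ln_pk; last 2 first.
- by move=> i; exact: Kp.
- by move=> i; rewrite tnth_mktuple p_mle_gt0.
rewrite -sumrB; apply: ler_sum => i _; rewrite tnth_mktuple.
set z := tnth t _; set th' := thetah _ t.
have dL0 : 0 <= delta * L z by rewrite mulr_ge0// ltW.
have Th' : Theta th' by exact: (mle t).1.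
have Tbd : ln (p z th') - ln (p z th) <= T z.
  apply: le_trans (HT _ Kth); rewrite lerD2r ler_ln ?posrE ?p_mle_gt0//.
    have := (mle [tuple z]).2 _ Th'.
    by rewrite /pk !big_ord_recl !big_ord0 !mulr1.
  have := pk_mle_gt0 [tuple z].
  by rewrite /pk !big_ord_recl !big_ord0 !mulr1.
have Lbd : enorm (th' - th) <= delta ->
    ln (p z th') - ln (p z th) <= L z * enorm (th' - th).
  move=> u; have Kth' : Kdelta Theta K delta th'.
    by split => //; exists th => //; rewrite enormB.
  have [_ [_ +]] := lip z Kth' (subset_Kdelta Kth).
  by apply: le_trans; exact: ler_norm.
rewrite /far; case: ifPn => [ue|]; last first.
  rewrite -leNgt => ue; rewrite !mulr0 !addr0.
  apply: (le_trans (Lbd (le_trans ue etad))).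
  by rewrite mulrC ler_wpM2r.
rewrite !mulr1; have [ud|ud] := leP (enorm (th' - th)) delta.
  apply: (le_trans (Lbd ud)); apply: (@le_trans _ _ (delta * L z)).
    by rewrite mulrC ler_wpM2r.
  by rewrite ler_wpDl ?mulr_ge0// lerDl.
by apply: (le_trans Tbd); rewrite ler_wpDl ?mulr_ge0// lerDr.
Qed.

(* The lower bound needs no control of the likelihood of the first block under
   the estimator: [thetah M] beats [thetah (N + M)] on the second block. *)
Lemma block_gain_ge N M th (t : (N + M).-tuple X) : K th ->
  mle_gap th t - mle_gap th (tsnd N M t) <= block_gain th t.
Proof.
move=> Kth; rewrite /mle_gap /block_gain ln_pk_cat ?pk_tfst_mle_gt0 ?pk_tsnd_mle_gt0//.
rewrite (ln_pk_cat (th := th)) ?pk_gt0//; try exact: Kp.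
have : ln (pk p M (tsnd N M t) (thetah (N + M)%N t)) <=
    ln (pk p M (tsnd N M t) (thetah M (tsnd N M t))).
  rewrite ler_ln ?posrE ?pk_tsnd_mle_gt0 ?pk_mle_gt0//.
  by apply: (mle (tsnd N M t)).2; exact: (mle t).1.
by lra.
Qed.

Lemma pk_lip (D : R) k th1 th2 (t : k.-tuple X) : K th1 -> K th2 ->
  enorm (th1 - th2) <= D ->
  `|ln (pk p k t th1) - ln (pk p k t th2)| <= D * sumc id L t.
Proof.
move=> K1 K2 hD; rewrite !ln_pk; [|by move=> i; exact: Kp|by move=> i; exact: Kp].
rewrite -sumrB; apply: (le_trans (ler_norm_sum _ _ _)).
rewrite /sumc mulr_sumr; apply: ler_sum => i _.
have [_ [_ h]] := lip (tnth t i) (subset_Kdelta K1) (subset_Kdelta K2).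
by apply: (le_trans h); rewrite mulrC ler_wpM2r.
Qed.

(** A Harnack-type comparison: the factor depends on the data but not on the two parameters, so it
    survives integration over [K] and makes a mixture comparable with each of its components. *)
Lemma pk_lip_le (D : R) k th1 th2 (t : k.-tuple X) : K th1 -> K th2 ->
  enorm (th1 - th2) <= D ->
  pk p k t th1 <= expR (D * sumc id L t) * pk p k t th2.
Proof.
move=> K1 K2 hD.
have pos th : K th -> pk p k t th \is Num.pos by move=> Kt; rewrite posrE pk_gt0//; exact: Kp.
rewrite -ler_ln ?pos ?posrE ?mulr_gt0 ?expR_gt0//; last by rewrite -posrE pos.
rewrite lnM ?pos ?posrE ?expR_gt0// expRK -lerBlDr.
by apply: le_trans (pk_lip t K1 K2 hD); exact: ler_norm.
Qed.

Lemma compact_diam : compact K ->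
  exists2 D : R, 0 <= D & forall th1 th2, K th1 -> K th2 -> enorm (th1 - th2) <= D.
Proof.
move=> cK; have [B [Breal hB]] := compact_bounded cK.
pose B' := Num.max 0 B + 1.
have B'0 : 0 <= B' by rewrite addr_ge0// le_max lexx.
have BB' : B < B' by rewrite /B' ltr_pwDr// le_max lexx orbT.
exists (Num.sqrt (dim%:R * (B' + B') ^+ 2)); first exact: sqrtr_ge0.
move=> th1 th2 K1 K2; apply: enorm_le; first by rewrite addr_ge0.
by apply: (le_trans (ler_normB _ _)); apply: lerD; exact: (hB _ BB').
Qed.

End pointwise.

(** * Finiteness and positivity of the mixture density *)

Section mixture.
Context (R : realType) (dim : nat) (d : measure_display) (X : measurableType d).
Variables (p : X -> 'rV[R]_dim -> R) (K : set 'rV[R]_dim) (D : R) (L : X -> R)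
  (pi : probability (Par R dim) R).
Hypothesis mp : measurable_fun setT (fun w : X * Par R dim => p w.1 w.2).
Hypothesis Kp : forall th, K th -> forall z, 0 < p z th.
Hypothesis mK : measurable (K : set (Par R dim)).
Hypothesis piK : pi (~` K) = 0%E.
Hypothesis pk_le : forall k th1 th2 (t : k.-tuple X), K th1 -> K th2 ->
  pk p k t th1 <= expR (D * sumc id L t) * pk p k t th2.

Definition gpi k (t : k.-tuple X) : R := fine (ppi p pi k t).

(** Off [K] the sign of the likelihood is unknown, so the indicator is inserted before any
    monotonicity argument. *)
Lemma integral_K (f : Par R dim -> \bar R) :
  (\int[pi]_th f th = \int[pi]_th (f th * (\1_K th)%:E))%E.
Proof.
apply: (eq_integral_negl (measurableC mK) piK) => th /contrapT Kth.
by rewrite indicE mem_set// mule1.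
Qed.

Lemma integral_K_cst (c : R) : (\int[pi]_th (c * \1_K th)%:E = c%:E)%E.
Proof.
transitivity (\int[pi]_th (cst c%:E th * (\1_K th)%:E))%E.
  by apply: eq_integral => th _; rewrite EFinM.
by rewrite -integral_K integral_cst//= [pi _]probability_setT mule1.
Qed.

Lemma ppiE k (t : k.-tuple X) :
  ppi p pi k t = (\int[pi]_th (pk p k t th * \1_K th)%:E)%E.
Proof. by rewrite /ppi integral_K; apply: eq_integral => th _; rewrite EFinM. Qed.

Let mpK k (t : k.-tuple X) :
  measurable_fun setT (fun th : Par R dim => (pk p k t th * \1_K th)%:E).
Proof.
apply/measurable_EFinP/measurable_funM => //.
exact: (measurable_pk_comp mp (f := cst t) (g := id)).
Qed.

Let pK0 k (t : k.-tuple X) th : 0 <= pk p k t th * \1_K th.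
Proof.
rewrite indicE; case: (boolP (th \in K)) => [/set_mem Kth|_]; last by rewrite mulr0.
by rewrite mulr1 ltW// pk_gt0//; exact: Kp.
Qed.

Lemma ppi_bounds k (t : k.-tuple X) th : K th ->
  ((expR (- (D * sumc id L t)) * pk p k t th)%:E <= ppi p pi k t /\
   ppi p pi k t <= (expR (D * sumc id L t) * pk p k t th)%:E)%E.
Proof.
move=> Kth; rewrite ppiE; split.
  rewrite -[leLHS]integral_K_cst; apply: ge0_le_integral => //.
  - move=> th' _; rewrite lee_fin !mulr_ge0 ?expR_ge0//.
    by rewrite ltW// pk_gt0//; exact: Kp.
  - by apply/measurable_EFinP; apply: measurable_funM.
  move=> th' _; rewrite lee_fin indicE; case: (boolP (th' \in K)) => [/set_mem Kth'|_].
    by rewrite !mulr1 expRN ler_pdivrMl ?expR_gt0// pk_le.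
  by rewrite !mulr0.
rewrite -[leRHS]integral_K_cst; apply: ge0_le_integral => //.
- by move=> th' _; rewrite lee_fin.
- by apply/measurable_EFinP; apply: measurable_funM.
move=> th' _; rewrite lee_fin indicE; case: (boolP (th' \in K)) => [/set_mem Kth'|_].
  by rewrite !mulr1 pk_le.
by rewrite !mulr0.
Qed.

Hypothesis K0 : K !=set0.

Lemma ppi_gpi k (t : k.-tuple X) : ppi p pi k t = (gpi t)%:E.
Proof.
have [th Kth] := K0; have [l u] := ppi_bounds t Kth.
rewrite /gpi fineK// fin_real//; apply/andP; split.
  by apply: lt_le_trans l; exact: ltNyr.
by apply: le_lt_trans u _; exact: ltry.
Qed.

Lemma gpi_gt0 k (t : k.-tuple X) : 0 < gpi t.
Proof.
have [th Kth] := K0; have [l _] := ppi_bounds t Kth.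
move: l; rewrite ppi_gpi lee_fin; apply: lt_le_trans.
by rewrite mulr_gt0 ?expR_gt0// pk_gt0//; exact: Kp.
Qed.

Lemma ln_gpi k (t : k.-tuple X) th : K th ->
  `|ln (gpi t) - ln (pk p k t th)| <= D * sumc id L t.
Proof.
move=> Kth; have [] := ppi_bounds t Kth; rewrite ppi_gpi !lee_fin => l u.
have pkp : 0 < pk p k t th by apply: pk_gt0; exact: Kp.
have gp := gpi_gt0 t.
have el e : ln (expR e * pk p k t th) = e + ln (pk p k t th).
  by rewrite lnM ?posrE ?expR_gt0// expRK.
have {}l : ln (expR (- (D * sumc id L t)) * pk p k t th) <= ln (gpi t).
  by rewrite ler_ln ?posrE ?mulr_gt0 ?expR_gt0.
have {}u : ln (gpi t) <= ln (expR (D * sumc id L t) * pk p k t th).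
  by rewrite ler_ln ?posrE ?mulr_gt0 ?expR_gt0.
by move: l u; rewrite !el ler_norml; lra.
Qed.

End mixture.

(** * Signed expectations and the CNML3 normalizer *)

(** Closeness to a real number excludes the infinite values; this is how (A4) and (A5) yield
    integrability. *)
Lemma abse_subr_le (R : realType) (x : \bar R) (c e : R) : (`|x - c%:E| <= e%:E)%E ->
  exists2 r, x = r%:E & `|r - c| <= e.
Proof. by case: x => [r| |] //=; rewrite lee_fin => h; exists r. Qed.

Lemma measurable_lne_comp d (T : measurableType d) (R : realType) (f : T -> \bar R) :
  measurable_fun setT f -> (forall x, 0 < f x)%E ->
  measurable_fun setT (fun x => lne (f x)).
Proof.
move=> mf f0.
rewrite (_ : (fun x => lne (f x)) =
    fun x => if (f x < +oo)%E then (ln (fine (f x)))%:E else +oo%E).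
  apply: measurable_fun_ifT => //; first exact: measurable_fun_lte.
  apply/measurable_EFinP; apply: (measurableT_comp (@measurable_ln R)).
  by apply: (measurableT_comp (fine_measurable measurableT)).
apply/funext => x; move: (f0 x); case: (f x) => [r| |] //=.
by move=> r0; rewrite ltry leNgt -lte_fin r0.
Qed.

Section signed_expectation.
Context (R : realType) (dim : nat) (d : measure_display) (X : measurableType d).
Variables (mu : {sigma_finite_measure set X -> \bar R})
  (muk : forall k, {measure set (k.-tuple X) -> \bar R})
  (p : X -> 'rV[R]_dim -> R).
Hypothesis muP : is_product_measure mu muk.
Hypothesis mp : measurable_fun setT (fun w : X * Par R dim => p w.1 w.2).
Variable th : 'rV[R]_dim.
Hypothesis pgt0 : forall z, 0 < p z th.
Hypothesis p1 : (\int[mu]_z (p z th)%:E = 1)%E.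

Definition Eint k (f : k.-tuple X -> R) :=
  (muk k).-integrable setT (fun t => (pk p k t th * f t)%:E).

Lemma Ek_abs k (f : k.-tuple X -> R) :
  (\int[muk k]_t `|(pk p k t th * f t)%:E|)%E = Ek muk p th (fun t => `|f t|)%R.
Proof.
apply: eq_integral => t _ /=; rewrite normrM gtr0_norm//; exact: pk_gt0.
Qed.

Lemma Eint_bound k (f g : k.-tuple X -> R) (B : R) :
  measurable_fun setT f -> measurable_fun setT g -> (forall t, `|f t| <= g t) ->
  (Ek muk p th g <= B%:E)%E -> Eint f /\ (Ek muk p th (fun t => `|f t|)%R <= B%:E)%E.
Proof.
move=> mf mg fg gB.
have fB : (Ek muk p th (fun t => `|f t|)%R <= B%:E)%E.
  apply: le_trans gB; apply: (Ek_le muk mp pgt0) => //.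
  exact: measurableT_comp.
split => //; apply/integrableP; split; first exact: (measurable_Ek mp).
by rewrite Ek_abs (le_lt_trans fB)// ltry.
Qed.

Lemma EkD_int k (f g : k.-tuple X -> R) : Eint f -> Eint g ->
  Ek muk p th (fun t => f t + g t) = (Ek muk p th f + Ek muk p th g)%E.
Proof.
move=> If Ig; rewrite /Ek -integralD//.
by apply: eq_integral => t _; rewrite mulrDr EFinD.
Qed.

Lemma EintD k (f g : k.-tuple X -> R) : Eint f -> Eint g -> Eint (fun t => f t + g t).
Proof.
move=> If Ig; have := integrableD measurableT If Ig.
by apply: eq_integrable => // t _; rewrite mulrDr EFinD.
Qed.

Lemma EintB k (f g : k.-tuple X -> R) : Eint f -> Eint g -> Eint (fun t => f t - g t).
Proof.
move=> If Ig; have := integrableB measurableT If Ig.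
by apply: eq_integrable => // t _; rewrite mulrBr EFinB.
Qed.

Lemma EkB_int k (f g : k.-tuple X -> R) : Eint f -> Eint g ->
  Ek muk p th (fun t => f t - g t) = (Ek muk p th f - Ek muk p th g)%E.
Proof.
move=> If Ig; rewrite /Ek -integralB//.
by apply: eq_integral => t _; rewrite mulrBr EFinB.
Qed.

Lemma Ek_le_int k (f g : k.-tuple X -> R) : Eint f -> Eint g -> (forall t, f t <= g t) ->
  (Ek muk p th f <= Ek muk p th g)%E.
Proof.
move=> If Ig fg; apply: le_integral => // t _.
by rewrite lee_fin ler_wpM2l// ltW// pk_gt0.
Qed.

Lemma measurable_sumc N k (e : 'I_N -> 'I_k) (f : X -> R) : measurable_fun setT f ->
  measurable_fun setT (sumc e f).
Proof.
move=> mf; apply: measurable_sum => i; apply: (measurableT_comp mf).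
exact: measurable_tnth.
Qed.

Lemma sumc_ge0 N k (e : 'I_N -> 'I_k) (f : X -> R) t : (forall z, 0 <= f z) ->
  0 <= sumc e f t.
Proof. by move=> f0; apply: sumr_ge0. Qed.

Lemma Ek_sumc N k (e : 'I_N -> 'I_k) (f : X -> R) (S : R) : measurable_fun setT f ->
  (forall z, 0 <= f z) -> (\int[mu]_z (p z th * f z)%:E <= S%:E)%E ->
  (Ek muk p th (sumc e f) <= (N%:R * S)%:E)%E.
Proof.
move=> mf f0 fS; rewrite (Ek_sum muk mp pgt0 (f := fun i t => f (tnth t (e i)))); last 2 first.
- by move=> i; apply: (measurableT_comp mf); exact: measurable_tnth.
- by move=> i t; exact: f0.
apply: (@le_trans _ _ (\sum_(i < N) S%:E)%E).
  apply: lee_sum => i _.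
  by rewrite (Ek_coord muP mp pgt0 p1 (e i) mf).
by rewrite sumEFin sumr_const card_ord mulr_natl.
Qed.

End signed_expectation.

Section normalizer.
Context (R : realType) (dim : nat) (d : measure_display) (X : measurableType d).
Variables (mu : {sigma_finite_measure set X -> \bar R})
  (muk : forall k, {measure set (k.-tuple X) -> \bar R})
  (p : X -> 'rV[R]_dim -> R) (Theta K : set 'rV[R]_dim)
  (thetah : forall k, k.-tuple X -> 'rV[R]_dim) (T : X -> R).
Arguments thetah : clear implicits.
Hypothesis muP : is_product_measure mu muk.
Hypothesis mp : measurable_fun setT (fun w : X * Par R dim => p w.1 w.2).
Hypothesis mth : forall k, measurable_fun setT (thetah k : k.-tuple X -> Par R dim).
Hypothesis p_ge0 : forall th, Theta th -> forall z, 0 <= p z th.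
Hypothesis mle : forall k (z : k.-tuple X), Theta (thetah k z) /\
     forall th, Theta th -> pk p k z th <= pk p k z (thetah k z).
Hypothesis KT : K `<=` Theta.
Hypothesis Kp : forall th, K th -> forall z, 0 < p z th.
Hypothesis K1 : forall th, K th -> (\int[mu]_z (p z th)%:E = 1)%E.
Hypothesis K0 : K !=set0.
Hypothesis T0 : forall z, 0 <= T z.
Hypothesis mT : measurable_fun setT T.
Hypothesis HT : forall z th, K th ->
     ln (p z (thetah 1%N [tuple z])) - ln (p z th) <= T z.
Variables (N M : nat).

Lemma measurable_thetah_comp d' (S : measurableType d') k (f : S -> k.-tuple X) :
  measurable_fun setT f ->
  measurable_fun setT (fun s => (thetah k (f s) : Par R dim)).
Proof.
move=> mf _ Y mY.
have := mf measurableT _ (mth measurableT mY).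
by rewrite !setTI.
Qed.

Notation Z := (Zcnml3 p muk thetah N M).

(** Where [Z x] is infinite the value is [ln 0 = 0] instead of [+oo]; by [Zinf_null] this concerns a
    null set. *)
Definition lnZ (x : N.-tuple X) : R := ln (fine (Z x)).

(** The maximal joint likelihood is at least the one at [th], and by [mle_gap_le] the first block
    accounts for a log-gain of at most [sumc id T x]; the second block can therefore lose no more
    than that. *)
Let mbd (x : N.-tuple X) (y : M.-tuple X) th : K th ->
  expR (- sumc id T x) * pk p M y th <= pk p M y (thetah (N + M)%N (cat_tuple x y)).
Proof.
move=> Kth; set t := catp (x, y).
have tx : tfst N M t = x by rewrite tfst_catp.
have ty : tsnd N M t = y by rewrite tsnd_catp.
have p1 := pk_tfst_mle_gt0 p_ge0 mle KT Kp K0 t.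
have p2 := pk_tsnd_mle_gt0 p_ge0 mle KT Kp K0 t.
have p3 k (z : k.-tuple X) : 0 < pk p k z th by apply: pk_gt0; exact: Kp.
have h1 : ln (pk p (N + M) t th) <= ln (pk p (N + M) t (thetah _ t)).
  rewrite ler_ln ?posrE//; first by apply: (mle t).2; exact: KT.
  exact: pk_mle_gt0 mle KT Kp K0 _ _.
have h2 : ln (pk p N x (thetah _ t)) <= ln (pk p N x (thetah _ x)).
  rewrite ler_ln ?posrE//; last exact: pk_mle_gt0 mle KT Kp K0 _ _.
    by apply: (mle x).2; exact: (mle t).1.
  by rewrite -[x in pk p N x]tx.
have h3 := mle_gap_le p_ge0 mle KT Kp K0 HT x Kth.
move: h1; rewrite !ln_pk_cat// tx ty => h1.
rewrite -/(catp (x, y)) -/t -ler_ln ?posrE ?mulr_gt0 ?expR_gt0//; last by rewrite -ty.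
rewrite lnM ?posrE ?expR_gt0// expRK; move: h1 h2 h3; rewrite /mle_gap; lra.
Qed.

(** Integrating [mbd] over [y], where the density at a point of [K] has mass 1. This makes [Z]
    positive and controls the negative part of its logarithm. *)
Lemma Z_ge (x : N.-tuple X) : ((expR (- sumc id T x))%:E <= Z x)%E.
Proof.
have [th Kth] := K0.
rewrite -[leLHS]mule1 -(integral_pk muP mp (Kp Kth) (K1 Kth) M).
rewrite -ge0_integralZl_EFin//; last 2 first.
- by move=> y _; rewrite lee_fin ltW// pk_gt0//; exact: Kp.
- by apply/measurable_EFinP; exact: measurable_pk.
apply: ge0_le_integral => //.
- by move=> y _; rewrite mule_ge0// lee_fin ?expR_ge0// ltW// pk_gt0//; exact: Kp.
- apply/measurable_EFinP/measurable_funM => //; exact: measurable_pk.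
- apply/measurable_EFinP; apply: (measurable_pk_comp mp) => //.
  apply: (measurable_thetah_comp (f := fun y => catp (x, y))).
  apply: (measurableT_comp (@measurable_catp _ _ N M)).
  exact: pair1_measurable.
- by move=> y _; rewrite -EFinM lee_fin; exact: mbd.
Qed.

Lemma Z_gt0 (x : N.-tuple X) : (0 < Z x)%E.
Proof. by apply: lt_le_trans (Z_ge x); rewrite lte_fin expR_gt0. Qed.

Lemma measurable_Z : measurable_fun setT (fun x => Z x).
Proof.
apply: (measurable_fun_fubini_tonelli_F (m2 := mukS muP M)
  (fun w => (pk p M w.2 (thetah (N + M)%N (catp w)))%:E)).
  apply/measurable_EFinP; apply: (measurable_pk_comp mp) => //.
  exact: (measurable_thetah_comp (@measurable_catp _ _ N M)).
move=> [x y] /=; rewrite lee_fin; apply: prodr_ge0 => i _; apply: p_ge0.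
exact: (mle (catp (x, y))).1.
Qed.

Lemma measurable_lnZ : measurable_fun setT lnZ.
Proof.
apply: (measurableT_comp (@measurable_ln R)).
exact: (measurableT_comp (fine_measurable measurableT) measurable_Z).
Qed.

Lemma lnZ_ge (x : N.-tuple X) : - sumc id T x <= lnZ x.
Proof.
rewrite /lnZ; have := Z_ge x; case: (Z x) => [r| |] //=.
  rewrite lee_fin => h; rewrite -[leLHS]expRK ler_ln ?posrE ?expR_gt0//.
  exact: lt_le_trans (expR_gt0 _) h.
by move=> _; rewrite ln0// oppr_le0 sumc_ge0.
Qed.

Definition Zinf : set (N.-tuple X) := [set x | Z x = +oo%E].

Lemma measurable_Zinf : measurable Zinf.
Proof.
have := emeasurable_fun_infty_o measurableT measurable_Z +oo%E.
rewrite setTI => /measurableC; congr measurable.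
apply/seteqP; split => x /=; rewrite /Zinf/=.
  by move/negP; rewrite -leNgt leye_eq => /eqP.
by move=> ->; rewrite ltxx.
Qed.

Variables (th : 'rV[R]_dim) (C e S : R).
Hypothesis Kth : K th.
Hypothesis hZ : (`| \int[muk N]_x ((pk p N x th)%:E * lne (Z x)) - C%:E | <= e%:E)%E.

(** By [hZ] the integral is a real number, so the integrand is integrable and a.e. finite; as
    [pk p N x th] is positive, an infinite [Z x] would make the integrand infinite. *)
Lemma Zinf_null : muk N Zinf = 0%E.
Proof.
have [r rE _] := abse_subr_le hZ.
have ml : measurable_fun setT (fun x => (pk p N x th)%:E * lne (Z x))%E.
  apply: emeasurable_funM; last exact: (measurable_lne_comp measurable_Z Z_gt0).
  by apply/measurable_EFinP; exact: measurable_pk.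
have If : (muk N).-integrable setT (fun x => (pk p N x th)%:E * lne (Z x))%E.
  by apply/integrableP; split => //; apply/(abse_integralP _ measurableT ml); rewrite rE ltry.
have /integrable_ae := If => /(_ measurableT) ae.
apply/(negligibleP _ measurable_Zinf).
apply: negligibleS ae => x; rewrite /Zinf /= => -> /(_ I).
by rewrite mulry gtr0_sg ?mul1e// pk_gt0//; exact: Kp.
Qed.

Lemma Ek_lnZ : Ek muk p th lnZ = (\int[muk N]_x ((pk p N x th)%:E * lne (Z x)))%E.
Proof.
apply: (eq_integral_negl measurable_Zinf Zinf_null) => x.
rewrite /Zinf /= /lnZ; have := Z_gt0 x; case: (Z x) => [z| |] //= z0 _.
by rewrite leNgt -lte_fin z0.
Qed.

Lemma Eint_lnZ : Eint muk p th lnZ.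
Proof.
have [r rE _] := abse_subr_le hZ.
have ml : measurable_fun setT (fun x => (pk p N x th * lnZ x)%:E).
  exact: (measurable_Ek mp _ measurable_lnZ).
apply/integrableP; split => //; apply/(abse_integralP _ measurableT ml).
by have := Ek_lnZ; rewrite /Ek => ->; rewrite rE ltry.
Qed.

(** Since [lnZ x >= - sumc id T x], the absolute value is at most [lnZ x + 2 * sumc id T x]. The
    resulting bound is free of [th], as the later integration against [pi] requires. *)
Lemma Ek_abs_lnZ : (\int[mu]_z (p z th * T z)%:E <= S%:E)%E ->
  (Ek muk p th (fun x => `|lnZ x|)%R <= (C + e + 2 * (N%:R * S))%:E)%E.
Proof.
move=> TS; have [r rE rC] := abse_subr_le hZ.
have pth := Kp Kth.
have msT := measurable_sumc (@id 'I_N) mT.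
have EsT := Ek_sumc muP mp pth (K1 Kth) (@id 'I_N) mT T0 TS.
have sTn (t : N.-tuple X) : `|sumc id T t| <= sumc id T t.
  by rewrite ger0_norm// sumc_ge0.
have [IsT _] := Eint_bound mp pth msT msT sTn EsT.
have IsT2 := EintD IsT IsT.
have IZ := Eint_lnZ.
apply: (@le_trans _ _ (Ek muk p th (fun x => lnZ x + (sumc id T x + sumc id T x)))).
  apply: (Ek_le muk mp pth).
  - by apply: measurableT_comp => //; exact: measurable_lnZ.
  - apply: measurable_funD; first exact: measurable_lnZ.
    exact: measurable_funD.
  - by move=> x; exact: normr_ge0.
  move=> x; have := lnZ_ge x; have := sumc_ge0 id x T0.
  by move=> h1 h2; rewrite ler_norml; apply/andP; split; lra.
rewrite (EkD_int IZ IsT2) (EkD_int IsT IsT) Ek_lnZ rE.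
apply: (@le_trans _ _ (r%:E + ((N%:R * S)%:E + (N%:R * S)%:E))%E).
  by rewrite leeD2l// leeD.
rewrite -!EFinD lee_fin; move: rC; rewrite ler_norml; lra.
Qed.

End normalizer.

(** * Mixtures over the parameter *)

Lemma measurable_ln_comp d (T : measurableType d) (R : realType) (f : T -> R) :
  measurable_fun setT f -> measurable_fun setT (fun x => ln (f x)).
Proof. by move=> mf; exact: (measurableT_comp (@measurable_ln R)). Qed.

Section marginal.
Context (R : realType) (dim : nat) (d : measure_display) (X : measurableType d).
Variables (mu : {sigma_finite_measure set X -> \bar R})
  (muk : forall k, {measure set (k.-tuple X) -> \bar R})
  (p : X -> 'rV[R]_dim -> R).
Hypothesis muP : is_product_measure mu muk.
Hypothesis mp : measurable_fun setT (fun w : X * Par R dim => p w.1 w.2).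

Lemma muk_null_tfst N M (A : set (N.-tuple X)) : measurable A -> muk N A = 0%E ->
  muk (N + M)%N (@tfst X N M @^-1` A) = 0%E.
Proof.
move=> mA A0.
have mB : measurable (@tfst X N M @^-1` A).
  by rewrite -[X in measurable X]setTI; exact: (@measurable_tfst _ X N M).
rewrite (muk_cat muP mB).
transitivity ((mukS muP N \x mukS muP M)%E (A `*` setT)).
  apply: (f_equal (mukS muP N \x mukS muP M)%E); apply/seteqP; split => w /=.
    by rewrite tfst_catp.
  by rewrite tfst_catp => -[].
by rewrite product_measure1E//= [mukS muP N A]A0 mul0e.
Qed.

Variable th : 'rV[R]_dim.
Hypothesis pgt0 : forall z, 0 < p z th.
Hypothesis p1 : (\int[mu]_z (p z th)%:E = 1)%E.

(** Both [f + |f|] and [|f|] are nonnegative, so [Ek_tfst] applies to them, and the signed case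
    follows by subtraction. *)
Lemma Ek_tfst_int N M (f : N.-tuple X -> R) (B : R) : measurable_fun setT f ->
  Eint muk p th f -> (Ek muk p th (fun x => `|f x|)%R <= B%:E)%E ->
  Eint muk p th (fun t => f (tfst N M t)) /\
  Ek muk p th (fun t => f (tfst N M t)) = Ek muk p th f.
Proof.
move=> mf If fB.
have maf : measurable_fun setT (fun x => `|f x|) by exact: measurableT_comp.
have mt (g : N.-tuple X -> R) : measurable_fun setT g ->
    measurable_fun setT (fun t => g (tfst N M t)).
  by move=> mg; apply: (measurableT_comp mg); exact: measurable_tfst.
have fB' : (Ek muk p th (fun t => `|f (tfst N M t)|)%R <= B%:E)%E.
  by rewrite (Ek_tfst muP mp pgt0 p1 M maf).
have [I1 _] := Eint_bound mp pgt0 (mt _ mf) (mt _ maf) (fun t => lexx _) fB'.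
have na N' (g : N'.-tuple X -> R) t : `| `|g t| | <= `|g t| by rewrite normr_id.
have [I2 _] := Eint_bound mp pgt0 (mt _ maf) (mt _ maf) (na _ _) fB'.
have [I3 _] := Eint_bound mp pgt0 maf maf (na _ _) fB.
split => //.
have IE : Ek muk p th (fun t => f (tfst N M t) + `|f (tfst N M t)|) =
    Ek muk p th (fun t => f t + `|f t|).
  rewrite (Ek_tfst muP mp pgt0 p1 M (f := fun x => f x + `|f x|))//.
    exact: measurable_funD.
  by move=> x; rewrite -lerBlDl sub0r; have := ler_norm (- f x); rewrite normrN.
move: IE; rewrite (EkD_int I1 I2) (EkD_int If I3).
rewrite (Ek_tfst muP mp pgt0 p1 M maf (fun x => normr_ge0 _)) => IE.
have fin : Ek muk p th (fun x => `|f x|) \is a fin_num.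
  rewrite ge0_fin_numE; first by apply: le_lt_trans fB _; exact: ltry.
  by apply: (Ek_ge0 muk pgt0) => x; exact: normr_ge0.
by rewrite -[LHS](addeK _ fin) IE addeK.
Qed.

End marginal.

Section mixed.
Context (R : realType) (dim : nat) (d : measure_display) (X : measurableType d).
Variables (mu : {sigma_finite_measure set X -> \bar R})
  (muk : forall k, {measure set (k.-tuple X) -> \bar R})
  (p : X -> 'rV[R]_dim -> R) (K : set 'rV[R]_dim) (pi : probability (Par R dim) R).
Hypothesis muP : is_product_measure mu muk.
Hypothesis mp : measurable_fun setT (fun w : X * Par R dim => p w.1 w.2).
Hypothesis Kp : forall th, K th -> forall z, 0 < p z th.
Hypothesis mK : measurable (K : set (Par R dim)).
Hypothesis piK : pi (~` K) = 0%E.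
Variables (k : nat) (h : Par R dim * k.-tuple X -> R) (B : R).
Hypothesis mh : measurable_fun setT h.
Hypothesis B0 : 0 <= B.
Hypothesis hB : forall th, K th -> (Ek muk p th (fun t => `|h (th, t)|)%R <= B%:E)%E.

(** The indicator makes the integrand vanish where neither the sign of the density nor the bound
    [hB] is known, so that Fubini can be applied on the whole product space. *)
Definition mixF (w : Par R dim * k.-tuple X) : \bar R :=
  (\1_K w.1 * (pk p k w.2 w.1 * h w))%:E.

Lemma measurable_mixF : measurable_fun setT mixF.
Proof.
apply/measurable_EFinP; apply: measurable_funM.
  by apply: (measurableT_comp (f := \1_K : Par R dim -> R)).
apply: measurable_funM => //.
exact: (measurable_pk_comp mp).
Qed.

Lemma mixF_in th : K th -> (\int[muk k]_t mixF (th, t))%E = Ek muk p th (fun t => h (th, t)).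
Proof.
move=> Kth; apply: eq_integral => t _.
by rewrite /mixF /= indicE mem_set// mul1r.
Qed.

Lemma mixF_integrable : (pi \x mukS muP k)%E.-integrable setT mixF.
Proof.
apply/(integrable12ltyP _ _ measurable_mixF).
have mG := measurable_fun_fubini_tonelli_F (m2 := mukS muP k) (abse \o mixF).
apply: (@le_lt_trans _ _ (\int[pi]_th (B * \1_K th)%:E)%E); last first.
  by rewrite (integral_K_cst mK piK) ltry.
apply: ge0_le_integral => //.
- by move=> th _; exact: integral_ge0.
- apply: mG; last by move=> w; exact: abse_ge0.
  by apply: measurableT_comp => //; exact: measurable_mixF.
- by apply/measurable_EFinP; apply: measurable_funM.
move=> th _; have [Kth|Kth] := pselect (K th); last first.
  rewrite indicE memNset// mulr0 integral0_eq// => t _.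
  by rewrite /mixF /= indicE memNset// mul0r normr0.
rewrite indicE mem_set// mulr1; apply: le_trans (hB Kth).
rewrite -(Ek_abs muk (Kp Kth)) le_eqVlt; apply/orP; left; apply/eqP.
by apply: eq_integral => t _; rewrite /mixF /= indicE mem_set// mul1r.
Qed.

Lemma mixF_integrable_th : pi.-integrable setT (fun th => \int[muk k]_t mixF (th, t))%E.
Proof. exact: integrable_fubini_F mixF_integrable. Qed.

Lemma mixF_Fubini : (\int[muk k]_t \int[pi]_th mixF (th, t) =
  \int[pi]_th \int[muk k]_t mixF (th, t))%E.
Proof. by rewrite (Fubini mixF_integrable). Qed.

End mixed.

(** * The identity at a fixed horizon *)

Section fixed_horizon.
Context (R : realType) (dim : nat) (d : measure_display) (X : measurableType d).
Variables (mu : {sigma_finite_measure set X -> \bar R})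
  (muk : forall k, {measure set (k.-tuple X) -> \bar R})
  (p : X -> 'rV[R]_dim -> R) (Theta K : set 'rV[R]_dim)
  (thetah : forall k, k.-tuple X -> 'rV[R]_dim) (delta : R) (L T : X -> R).
Arguments thetah : clear implicits.
Hypothesis muP : is_product_measure mu muk.
Hypothesis mp : measurable_fun setT (fun w : X * Par R dim => p w.1 w.2).
Hypothesis mth : forall k, measurable_fun setT (thetah k : k.-tuple X -> Par R dim).
Hypothesis p_ge0 : forall th, Theta th -> forall z, 0 <= p z th.
Hypothesis mle : forall k (z : k.-tuple X), Theta (thetah k z) /\
     forall th, Theta th -> pk p k z th <= pk p k z (thetah k z).
Hypothesis KT : K `<=` Theta.
Hypothesis Kp : forall th, K th -> forall z, 0 < p z th.
Hypothesis K1 : forall th, K th -> (\int[mu]_z (p z th)%:E = 1)%E.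
Hypothesis K0 : K !=set0.
Hypothesis delta0 : 0 < delta.
Hypothesis L0 : forall z, 0 <= L z.
Hypothesis mL : measurable_fun setT L.
Hypothesis T0 : forall z, 0 <= T z.
Hypothesis mT : measurable_fun setT T.
Hypothesis lip : forall z th1 th2, Kdelta Theta K delta th1 -> Kdelta Theta K delta th2 ->
     0 < p z th1 /\ 0 < p z th2 /\
     `|ln (p z th1) - ln (p z th2)| <= L z * enorm (th1 - th2).
Hypothesis HT : forall z th, K th ->
     ln (p z (thetah 1%N [tuple z])) - ln (p z th) <= T z.
Variables (N M : nat) (e eta C c S : R).
Hypothesis S0 : 0 <= S.
Hypothesis e0 : 0 <= e.
Hypothesis eta0 : 0 <= eta.
Hypothesis etad : eta <= delta.
Hypothesis ELS : forall th, K th -> (\int[mu]_z (p z th * L z)%:E <= S%:E)%E.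
Hypothesis ETS : forall th, K th -> (\int[mu]_z (p z th * T z)%:E <= S%:E)%E.
Hypothesis EW : forall k, k = (N + M)%N \/ k = M -> forall th, K th ->
  (`|Ek muk p th (@mle_gap _ _ _ X p thetah k th) - c%:E| <= e%:E)%E.
Hypothesis EU : forall th, K th ->
  (Ek muk p th (@block_gain_ub _ _ _ X thetah delta L T N M eta th) <= e%:E)%E.
Hypothesis hZ : forall th, K th ->
  (`| \int[muk N]_x ((pk p N x th)%:E * lne (Zcnml3 p muk thetah N M x)) - C%:E |
    <= e%:E)%E.

Notation Wt th := (@mle_gap _ _ _ X p thetah (N + M)%N th).
Notation Wm th := (fun t : (N + M).-tuple X => mle_gap p thetah th (tsnd N M t)).
Notation Gt th := (@block_gain _ _ _ X p thetah N M th).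
Notation Ut th := (@block_gain_ub _ _ _ X thetah delta L T N M eta th).
Notation lZ := (@lnZ R dim d X muk p thetah N M).
Notation lz := (fun t : (N + M).-tuple X => lZ (tfst N M t)).

Lemma measurable_ln_pk d' (S' : measurableType d') k
    (f : S' -> k.-tuple X) (g : S' -> Par R dim) :
  measurable_fun setT f -> measurable_fun setT g ->
  measurable_fun setT (fun s => ln (pk p k (f s) (g s))).
Proof. by move=> mf mg; apply: measurable_ln_comp; exact: measurable_pk_comp. Qed.

Lemma measurable_mle_gap k th : measurable_fun setT (@mle_gap _ _ _ X p thetah k th).
Proof.
apply: measurable_funB; apply: measurable_ln_pk => //.
exact: mth.
Qed.

Lemma measurable_Wm th : measurable_fun setT (Wm th).
Proof. by apply: (measurableT_comp (measurable_mle_gap th)); exact: measurable_tsnd. Qed.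

Lemma measurable_block_gain th : measurable_fun setT (Gt th).
Proof.
apply: measurable_funB; apply: measurable_ln_pk => //; try exact: measurable_tfst.
exact: mth.
Qed.

Lemma measurable_block_gain_ub th : measurable_fun setT (Ut th).
Proof.
have mc (f : X -> R) i : measurable_fun setT f ->
    measurable_fun setT (fun t : (N + M).-tuple X => f (tnth t i)).
  by move=> mf; apply: (measurableT_comp mf); exact: measurable_tnth.
have mfar := @measurable_far _ _ _ _ thetah mth (N + M)%N th eta.
apply: measurable_sum => i; apply: measurable_funD.
  by apply: measurable_funM => //; exact: mc.
apply: measurable_funD; first apply: measurable_funM => //.
  by apply: measurable_funM => //; exact: mc.
by apply: measurable_funM => //; exact: mc.
Qed.

Lemma measurable_lz : measurable_fun setT lz.
Proof.
apply: measurableT_comp; last exact: measurable_tfst.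
exact: (measurable_lnZ muP mp mth p_ge0 mle).
Qed.

Lemma block_gain_ub_ge0 th t : 0 <= Ut th t.
Proof.
apply: sumr_ge0 => i _; rewrite !addr_ge0 ?mulr_ge0 ?far_ge0//; exact: ltW.
Qed.

(** In [Gt - Wt] the first block cancels and [ln p(y^M|th) - ln p(y^M|MLE)] remains. Where the
    normalizer is finite, the whole is the logarithm of [p(y^M|th)] over the CNML3 density. *)
Definition log_excess th (t : (N + M).-tuple X) : R := (Gt th t - Wt th t) + lz t.

Lemma measurable_log_excess th : measurable_fun setT (log_excess th).
Proof.
apply: measurable_funD; last exact: measurable_lz.
by apply: measurable_funB; [exact: measurable_block_gain|exact: measurable_mle_gap].
Qed.

Let Wt_ge0 th t : K th -> 0 <= Wt th t.
Proof. by move=> Kth; exact: (mle_gap_ge0 mle KT Kp K0). Qed.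

Let Wm_ge0 th t : K th -> 0 <= Wm th t.
Proof. by move=> Kth; exact: (mle_gap_ge0 mle KT Kp K0). Qed.

Let EW_le th : K th -> (Ek muk p th (Wt th) <= (c + e)%:E)%E.
Proof.
move=> Kth; have [r -> h] := abse_subr_le (EW (or_introl erefl) Kth).
by rewrite lee_fin; move: h; rewrite ler_norml; lra.
Qed.

Let EWmE th : K th -> Ek muk p th (Wm th) = Ek muk p th (@mle_gap _ _ _ X p thetah M th).
Proof.
move=> Kth; rewrite (Ek_tsnd muP mp (Kp Kth) (K1 Kth) N (measurable_mle_gap th))// => t.
exact: (mle_gap_ge0 mle KT Kp K0).
Qed.

Let EWm_le th : K th -> (Ek muk p th (Wm th) <= (c + e)%:E)%E.
Proof.
move=> Kth; rewrite EWmE//.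
have [r -> h] := abse_subr_le (EW (or_intror erefl) Kth).
by rewrite lee_fin; move: h; rewrite ler_norml; lra.
Qed.

Let EZ th : K th -> [/\ Eint muk p th lz,
  (`|Ek muk p th lz - C%:E| <= e%:E)%E &
  (Ek muk p th (fun t => `|lz t|)%R <= (C + e + 2 * (N%:R * S))%:E)%E].
Proof.
move=> Kth.
have mZ := @measurable_lnZ _ _ _ _ _ _ _ _ _ muP mp mth p_ge0 mle N M.
have IZ := Eint_lnZ muP mp mth p_ge0 mle KT Kp K1 K0 HT Kth (hZ Kth).
have aZ := Ek_abs_lnZ muP mp mth p_ge0 mle KT Kp K1 K0 T0 mT HT Kth (hZ Kth) (ETS Kth).
have [I1 E1] := Ek_tfst_int muP mp (Kp Kth) (K1 Kth) M mZ IZ aZ.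
split => //.
  by rewrite E1 (Ek_lnZ muP mp mth p_ge0 mle KT Kp K1 K0 HT Kth (hZ Kth)) hZ.
rewrite (Ek_tfst muP mp (Kp Kth) (K1 Kth) M (f := fun x => `|lZ x|))//.
exact: measurableT_comp.
Qed.

(** Besides [Gt <= Ut] one has [Gt >= Wt - Wm >= - Wm], as [Wt] is nonnegative. *)
Let G_abs th t : K th -> `|Gt th t| <= Ut th t + Wm th t.
Proof.
move=> Kth.
have h1 := block_gain_le p_ge0 mle KT Kp K0 delta0 L0 T0 lip HT t Kth eta0 etad.
have h2 := block_gain_ge p_ge0 mle KT Kp K0 t Kth.
have h3 := Wt_ge0 t Kth; have h4 := Wm_ge0 t Kth; have h5 := block_gain_ub_ge0 th t.
by rewrite ler_norml; apply/andP; split; lra.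
Qed.

Let EG_le th : K th -> (Ek muk p th (fun t => Ut th t + Wm th t)%R <= (e + (c + e))%:E)%E.
Proof.
move=> Kth; rewrite (EkD muk mp (Kp Kth) (measurable_block_gain_ub th) (measurable_Wm th)).
- by rewrite EFinD; apply: leeD; [exact: EU|exact: EWm_le].
- exact: block_gain_ub_ge0.
- by move=> t; exact: Wm_ge0.
Qed.

Let gint th (f : (N + M).-tuple X -> R) B : K th -> measurable_fun setT f ->
  (forall t, 0 <= f t) -> (Ek muk p th f <= B%:E)%E -> Eint muk p th f.
Proof.
move=> Kth mf f0 fB; apply: (proj1 (Eint_bound (g := f) mp (Kp Kth) mf mf _ fB)).
by move=> t; rewrite ger0_norm.
Qed.

(** The summands bound the expectations of [|Gt|], [Wt] and [|lz|]; what matters is that [th] does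
    not occur. *)
Definition log_excess_abs_bound : R := (e + (c + e)) + (c + e) + (C + e + 2 * (N%:R * S)).

(** The error adds up as follows: the expectation of [Gt] lies between a difference of two gap
    expectations, at least [- 2 * e], and [e]; [Wt] and [lz] contribute [e] each. *)
Lemma log_excess_bound th : K th ->
  [/\ Eint muk p th (log_excess th),
   (Ek muk p th (fun t => `|log_excess th t|)%R <= log_excess_abs_bound%:E)%E &
   (`|Ek muk p th (log_excess th) - (C - c)%:E| <= (4 * e)%:E)%E].
Proof.
move=> Kth; have pth := Kp Kth.
have mG := measurable_block_gain th; have mU := measurable_block_gain_ub th.
have mW : measurable_fun setT (Wt th) by exact: measurable_mle_gap.
have mWm := measurable_Wm th; have ml := measurable_lz.
have mUW : measurable_fun setT (fun t => Ut th t + Wm th t) by exact: measurable_funD.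
have [Iz zC za] := EZ Kth.
have IW : Eint muk p th (Wt th).
  by apply: gint (EW_le Kth) => // t; exact: Wt_ge0.
have IWm : Eint muk p th (Wm th).
  by apply: gint (EWm_le Kth) => // t; exact: Wm_ge0.
have IU : Eint muk p th (Ut th) by apply: gint (EU Kth) => //; exact: block_gain_ub_ge0.
have [IG _] := Eint_bound mp pth mG mUW (fun t => G_abs t Kth) (EG_le Kth).
have IWW : Eint muk p th (fun t => Wt th t - Wm th t).
  exact: EintB.
have IGW : Eint muk p th (fun t => Gt th t - Wt th t).
  exact: EintB.
have IV : Eint muk p th (log_excess th) by exact: EintD.
split => //.
  apply: (@le_trans _ _ (Ek muk p th
      (fun t => (Ut th t + Wm th t) + Wt th t + `|lz t|))%R).
    apply: (Ek_le muk mp pth).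
    - by apply: measurableT_comp => //; exact: measurable_log_excess.
    - apply: measurable_funD; first exact: measurable_funD.
      exact: measurableT_comp.
    - by move=> t; exact: normr_ge0.
    move=> t; apply: (le_trans (ler_normD _ _)); rewrite lerD2r.
    apply: (le_trans (ler_normB _ _)); apply: lerD; first exact: G_abs.
    by rewrite ger0_norm// Wt_ge0.
  have UW0 t : 0 <= Ut th t + Wm th t by rewrite addr_ge0 ?block_gain_ub_ge0// Wm_ge0.
  rewrite (EkD muk mp pth (f := fun t => (Ut th t + Wm th t) + Wt th t)); last 4 first.
  - exact: measurable_funD.
  - exact: measurableT_comp.
  - by move=> t; rewrite addr_ge0// Wt_ge0.
  - by move=> t; exact: normr_ge0.
  rewrite (EkD muk mp pth mUW mW UW0); last by move=> t; exact: Wt_ge0.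
  rewrite /log_excess_abs_bound !EFinD; apply: leeD; last by rewrite -!EFinD.
  by apply: leeD; [rewrite -!EFinD; exact: EG_le|rewrite -EFinD; exact: EW_le].
have gU : (Ek muk p th (Gt th) <= Ek muk p th (Ut th))%E.
  apply: (Ek_le_int pth) => // t.
  exact: (block_gain_le p_ge0 mle KT Kp K0 delta0 L0 T0 lip HT t Kth).
have gW : (Ek muk p th (fun t => Wt th t - Wm th t)%R <= Ek muk p th (Gt th))%E.
  apply: (Ek_le_int pth) => // t.
  exact: (block_gain_ge p_ge0 mle KT Kp K0 t Kth).
have [w wE hw] := abse_subr_le (EW (or_introl erefl) Kth).
have [wm wmE hwm] := abse_subr_le (EW (or_intror erefl) Kth).
have [z zE hz] := abse_subr_le zC.
move: gU gW; rewrite (EkB_int IW IWm) EWmE// (EkD_int IGW Iz) (EkB_int IG IW) wE wmE zE.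
move=> /le_trans/(_ (EU Kth)); case: (Ek muk p th (Gt th)) => [g| |] //=.
rewrite -?EFinB -?EFinD !lee_fin => h1 h2.
by move: hw hwm hz; rewrite !ler_norml; lra.
Qed.

Variables (pi : probability (Par R dim) R) (D : R).
Hypothesis D0 : 0 <= D.
Hypothesis mK : measurable (K : set (Par R dim)).
Hypothesis piK : pi (~` K) = 0%E.
Hypothesis KD : forall th1 th2, K th1 -> K th2 -> enorm (th1 - th2) <= D.

Let pk_le k th1 th2 (t : k.-tuple X) : K th1 -> K th2 ->
  pk p k t th1 <= expR (D * sumc id L t) * pk p k t th2.
Proof.
move=> K1' K2'; exact: (pk_lip_le KT Kp delta0 L0 lip t K1' K2' (KD K1' K2')).
Qed.

Let ppiE' k (t : k.-tuple X) : ppi p pi k t = (gpi p pi t)%:E.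
Proof. exact: ppi_gpi mp Kp mK piK pk_le K0 _ _. Qed.

Let gp_gt0 k (t : k.-tuple X) : 0 < gpi p pi t.
Proof. exact: gpi_gt0 mp Kp mK piK pk_le K0 _ _. Qed.

Let mgpi k : measurable_fun setT (fun t : k.-tuple X => gpi p pi t).
Proof.
apply: (measurableT_comp (fine_measurable measurableT)).
rewrite (_ : ppi p pi k = fun t => (\int[pi]_th (pk p k t th * \1_K th)%:E)%E); last first.
  by apply/funext => t; exact: (ppiE p mK piK).
apply: (measurable_fun_fubini_tonelli_F (m2 := pi)
  (fun w => (pk p k w.1 w.2 * \1_K w.2)%:E)).
  apply/measurable_EFinP; apply: measurable_funM; first exact: (measurable_pk_comp mp).
  by apply: (measurableT_comp (f := \1_K : Par R dim -> R)).
move=> [t th] /=; rewrite lee_fin indicE.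
case: (boolP (th \in K)) => [/set_mem Kth|_]; last by rewrite mulr0.
by rewrite mulr1 ltW// pk_gt0//; exact: Kp.
Qed.

(** The log-ratio of [p(y^M|th)] to the Bayesian predictive density. It is kept apart from [h2]
    because each piece needs its own integrability before the two integrals may be added. *)
Definition h1 (w : Par R dim * (N + M).-tuple X) : R :=
  ln (pk p M (tsnd N M w.2) w.1) - ln (gpi p pi w.2) + ln (gpi p pi (tfst N M w.2)).

(** The log-ratio of the Bayesian predictive density to the CNML3 density, wherever the normalizer
    is finite. Unlike [h1] it does not involve [th]. *)
Definition h2 (t : (N + M).-tuple X) : R :=
  ln (gpi p pi t) - ln (gpi p pi (tfst N M t)) -
  ln (pk p M (tsnd N M t) (thetah (N + M)%N t)) + lz t.

Lemma measurable_h1 : measurable_fun setT h1.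
Proof.
apply: measurable_funD; first apply: measurable_funB.
- apply: measurable_ln_pk => //.
  by apply: (measurableT_comp (@measurable_tsnd _ X N M)).
- apply: measurable_ln_comp.
  by apply: (measurableT_comp (@mgpi _)).
- apply: measurable_ln_comp.
  apply: (measurableT_comp (@mgpi _)).
  by apply: (measurableT_comp (@measurable_tfst _ X N M)).
Qed.

Lemma measurable_h2 : measurable_fun setT h2.
Proof.
apply: measurable_funD; last exact: measurable_lz.
apply: measurable_funB; first apply: measurable_funB.
- by apply: measurable_ln_comp; exact: mgpi.
- apply: measurable_ln_comp; apply: (measurableT_comp (@mgpi _)).
  exact: measurable_tfst.
- by apply: measurable_ln_pk; [exact: measurable_tsnd|exact: mth].
Qed.

Lemma h1D2 th t : K th -> h1 (th, t) + h2 t = log_excess th t.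
Proof.
move=> Kth; rewrite /h1 /h2 /log_excess /block_gain /mle_gap /=.
rewrite (ln_pk_cat (pk_tfst_mle_gt0 p_ge0 mle KT Kp K0 t) (pk_tsnd_mle_gt0 p_ge0 mle KT Kp K0 t)).
rewrite (ln_pk_cat (th := th)) ?pk_gt0//; try exact: Kp.
by lra.
Qed.

(** For [D, S > 0] this grows with [M], harmlessly: it serves integrability at a fixed horizon and
    leaves no trace in the final error [4 * e]. *)
Definition h1_bound : R := D * ((N + M)%:R * S) + D * (N%:R * S).

(** Inserting the log-likelihood of the first block at [th] exhibits [h1] as a difference of two
    terms bounded by [ln_gpi], one for the whole sample and one for the first block. *)
Let h1_abs th t : K th ->
  `|h1 (th, t)| <= D * sumc id L t + D * sumc (@lshift N M) L t.
Proof.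
move=> Kth.
have a := ln_gpi mp Kp mK piK pk_le K0 t Kth.
have b := ln_gpi mp Kp mK piK pk_le K0 (tfst N M t) Kth.
have sE : sumc id L (tfst N M t) = sumc (@lshift N M) L t.
  by apply: eq_bigr => i _; rewrite tnth_mktuple.
move: a b; rewrite sE (ln_pk_cat (th := th)) ?pk_gt0//; [|exact: Kp|exact: Kp].
by rewrite /h1 /= !ler_norml; lra.
Qed.

Lemma Eh1 th : K th -> (Ek muk p th (fun t => `|h1 (th, t)|)%R <= h1_bound%:E)%E.
Proof.
move=> Kth; have pth := Kp Kth.
have ms1 := measurable_sumc (@id 'I_(N + M)) mL.
have ms2 := measurable_sumc (@lshift N M) mL.
apply: (@le_trans _ _ (Ek muk p th
    (fun t => D * sumc id L t + D * sumc (@lshift N M) L t)%R)).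
  apply: (Ek_le muk mp pth).
  - apply: measurableT_comp => //; apply: (measurableT_comp measurable_h1).
    exact: pair1_measurable.
  - by apply: measurable_funD; apply: measurable_funM.
  - by move=> t; exact: normr_ge0.
  - by move=> t; exact: h1_abs.
rewrite (EkD muk mp pth (f := fun t => D * sumc id L t)); last 4 first.
- exact: measurable_funM.
- exact: measurable_funM.
- by move=> t; rewrite mulr_ge0// sumc_ge0.
- by move=> t; rewrite mulr_ge0// sumc_ge0.
rewrite (EkZ muk mp pth ms1)//; last by move=> t; exact: sumc_ge0.
rewrite (EkZ muk mp pth ms2)//; last by move=> t; exact: sumc_ge0.
rewrite /h1_bound EFinD; apply: leeD; rewrite EFinM; apply: lee_wpmul2l; rewrite ?lee_fin//.
  exact: (Ek_sumc muP mp pth (K1 Kth) _ mL L0 (ELS Kth)).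
exact: (Ek_sumc muP mp pth (K1 Kth) _ mL L0 (ELS Kth)).
Qed.

(** The bound is indirect, through [h2 = log_excess th - h1 (th, _)], where both terms are already
    controlled. *)
Lemma Eh2 th : K th ->
  (Ek muk p th (fun t => `|h2 t|)%R <= (log_excess_abs_bound + h1_bound)%:E)%E.
Proof.
move=> Kth; have pth := Kp Kth.
have mV : measurable_fun setT (fun t => `|log_excess th t|).
  by apply: measurableT_comp => //; exact: measurable_log_excess.
have mh : measurable_fun setT (fun t => `|h1 (th, t)|).
  apply: measurableT_comp => //; apply: (measurableT_comp measurable_h1).
  exact: pair1_measurable.
apply: (@le_trans _ _ (Ek muk p th (fun t => `|log_excess th t| + `|h1 (th, t)|)%R)).
  apply: (Ek_le muk mp pth).
  - by apply: measurableT_comp => //; exact: measurable_h2.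
  - exact: measurable_funD.
  - by move=> t; exact: normr_ge0.
  move=> t; have -> : h2 t = log_excess th t - h1 (th, t) by rewrite -(h1D2 t Kth); lra.
  exact: ler_normB.
rewrite (EkD muk mp pth mV mh (fun t => normr_ge0 _) (fun t => normr_ge0 _)).
by rewrite EFinD; apply: leeD; [case: (log_excess_bound Kth)|exact: Eh1].
Qed.

Let Ih1 th : K th -> Eint muk p th (fun t => h1 (th, t)).
Proof.
move=> Kth.
have mh : measurable_fun setT (fun t => h1 (th, t)).
  by apply: (measurableT_comp measurable_h1); exact: pair1_measurable.
have mah : measurable_fun setT (fun t => `|h1 (th, t)|) by exact: measurableT_comp.
by have [] := Eint_bound mp (Kp Kth) mh mah (fun t => lexx _) (Eh1 Kth).
Qed.

Let Ih2 th : K th -> Eint muk p th h2.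
Proof.
move=> Kth; have mh := measurable_h2.
have mah : measurable_fun setT (fun t => `|h2 t|) by exact: measurableT_comp.
by have [] := Eint_bound mp (Kp Kth) mh mah (fun t => lexx _) (Eh2 Kth).
Qed.

Lemma RKL_h1 th : K th ->
  RKL p muk N M (ppred p pi N M) th = Ek muk p th (fun t => h1 (th, t)).
Proof.
move=> Kth; have pth := Kp Kth.
have [E [A [mA A0 sub]]] := integral_muk_cat muP (Ih1 Kth).
rewrite /Ek E; apply: (eq_integral_negl mA A0) => x Ax.
have pkx : 0 < pk p N x th by exact: pk_gt0.
have Ix : (muk M).-integrable setT
    (fun y => (pk p (N + M) (catp (x, y)) th * h1 (th, catp (x, y)))%:E).
  by apply: contra_notP Ax => nI; exact: sub.
have inner y : ((pk p M y th)%:E *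
    lne ((pk p M y th)%:E * (ppred p pi N M x y)^-1) =
    (pk p M y th * h1 (th, catp (x, y)))%:E)%E.
  rewrite /ppred !ppiE' inver gt_eqF// -EFinM.
  rewrite lne_ratio ?pk_gt0// ?divr_gt0// -EFinM; congr (_ * _)%:E.
  rewrite /h1 /= tfst_catp tsnd_catp /= ln_div ?posrE// /catp /=.
  by rewrite opprB addrA addrAC.
under [in LHS]eq_integral do rewrite inner.
have Iy : (muk M).-integrable setT (fun y => (pk p M y th * h1 (th, catp (x, y)))%:E).
  have := integrableZl measurableT (pk p N x th)^-1 Ix.
  apply: eq_integrable => // y _; rewrite -EFinM pk_catp.
  by rewrite -!mulrA mulKf// gt_eqF.
rewrite -integralZl//; apply: eq_integral => y _.
by rewrite -EFinM pk_catp mulrA.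
Qed.

Lemma Dq_h2 : Dq p muk N M (qcnml3 p muk thetah N M) pi =
  (\int[muk (N + M)%N]_t (gpi p pi t * h2 t)%:E)%E.
Proof.
have [th Kth] := K0.
have mZi := @measurable_Zinf _ _ _ _ _ _ _ _ _ muP mp mth p_ge0 mle N M.
have Z0 := Zinf_null muP mp mth p_ge0 mle KT Kp K1 K0 HT Kth (hZ Kth).
(* Whether the normalizer is infinite depends on the first block only, so a null set of [x] gives a
   null set of samples. *)
have mA : measurable (@tfst X N M @^-1` Zinf muk p thetah (N := N) M).
  by rewrite -[X in measurable X]setTI; exact: (@measurable_tfst _ X N M).
apply: (eq_integral_negl mA (muk_null_tfst muP M mZi Z0)) => t.
rewrite /Zinf /preimage /= => Zt.
have := Z_gt0 muP mp mth p_ge0 mle KT Kp K1 K0 HT M (tfst N M t).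
rewrite /qcnml3 !ppiE' catp_tfst_tsnd /h2 /lnZ.
case: (Zcnml3 _ _ _ _ _ _) Zt => [z| |] //= _; rewrite lte_fin => z0.
have q0 := pk_tsnd_mle_gt0 p_ge0 mle KT Kp K0 t.
rewrite inver gt_eqF// -!EFinM lne_ratio ?mulr_gt0 ?invr_gt0//.
rewrite -EFinM; congr (_ * _)%:E.
rewrite lnM ?posrE ?divr_gt0// ln_div ?posrE//; lra.
Qed.

Notation F1 := (mixF p K h1).
Notation F2 := (mixF p K (fun w => h2 w.2)).

(** Expanding the outer mixture density as an integral over [pi] produces the double integral to
    which Fubini applies. *)
Lemma Dq_mix : Dq p muk N M (qcnml3 p muk thetah N M) pi =
  (\int[muk (N + M)%N]_t \int[pi]_th F2 (th, t))%E.
Proof.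
rewrite Dq_h2; apply: eq_integral => t _.
have m1 : measurable_fun setT (fun th : Par R dim => (pk p (N + M) t th * \1_K th)%:E).
  apply/measurable_EFinP/measurable_funM => //.
  exact: (measurable_pk_comp mp (f := cst t) (g := id)).
have nn th : 0 <= pk p (N + M) t th * \1_K th.
  rewrite indicE; case: (boolP (th \in K)) => [/set_mem Kth|_]; last by rewrite mulr0.
  by rewrite mulr1 ltW// pk_gt0//; exact: Kp.
have I1 : pi.-integrable setT (fun th : Par R dim => (pk p (N + M) t th * \1_K th)%:E).
  apply/integrableP; split => //.
  under eq_integral do rewrite gee0_abs ?lee_fin//.
  by rewrite -(ppiE p mK piK) ppiE' ltry.
transitivity ((h2 t)%:E * \int[pi]_th (pk p (N + M) t th * \1_K th)%:E)%E.
  by rewrite -(ppiE p mK piK) ppiE' -EFinM mulrC.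
rewrite -integralZl//; apply: eq_integral => th _.
by rewrite /mixF /= -EFinM; congr EFin; rewrite mulrC (mulrC (pk _ _ _ _)) mulrA.
Qed.

Let bounds : 0 <= h1_bound /\ 0 <= log_excess_abs_bound + h1_bound.
Proof.
have h10 : 0 <= h1_bound by rewrite addr_ge0// mulr_ge0// mulr_ge0.
split => //; have [th Kth] := K0.
(* As [C] is an arbitrary real, the sign is not visible from the formula; it is read off from the
   nonnegative expectation that [Eh2] bounds. *)
rewrite -lee_fin; apply: le_trans (Eh2 Kth).
by apply: (Ek_ge0 muk (Kp Kth)) => t; exact: normr_ge0.
Qed.

Lemma Dq_RKLpi_bound :
  (`|Dq p muk N M (qcnml3 p muk thetah N M) pi + RKLpi p muk N M pi - (C - c)%:E|
     <= (4 * e)%:E)%E.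
Proof.
have [b1 b2] := bounds.
have mh2 : measurable_fun setT (fun w : Par R dim * (N + M).-tuple X => h2 w.2).
  by apply: (measurableT_comp measurable_h2).
have J1 := mixF_integrable_th muP mp Kp mK piK measurable_h1 Eh1.
have J2 := mixF_integrable_th muP mp Kp mK piK mh2 Eh2.
have -> : Dq p muk N M (qcnml3 p muk thetah N M) pi =
    (\int[pi]_th \int[muk (N + M)%N]_t F2 (th, t))%E.
  by rewrite Dq_mix (mixF_Fubini muP mp Kp mK piK mh2 Eh2).
have -> : RKLpi p muk N M pi = (\int[pi]_th \int[muk (N + M)%N]_t F1 (th, t))%E.
  apply: (eq_integral_negl (measurableC mK) piK) => th /contrapT Kth.
  by rewrite RKL_h1// mixF_in.
have Jc : pi.-integrable setT (cst (C - c)%:E) by exact: finite_measure_integrable_cst.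
have -> : (C - c)%:E = (\int[pi]_th cst (C - c)%:E th)%E.
  by rewrite integral_cst//= [pi _]probability_setT mule1.
have J12 := integrableD measurableT J2 J1.
have mJ := measurable_int _ (integrableB measurableT J12 Jc).
rewrite -(integralD measurableT J2 J1) -(integralB measurableT J12 Jc).
apply: le_trans (le_abse_integral _ measurableT mJ) _.
apply: (@le_trans _ _ (\int[pi]_th cst (4 * e)%:E th)%E); last first.
  by rewrite integral_cst//= [pi _]probability_setT mule1.
apply: ae_ge0_le_integral => //.
- exact: measurableT_comp mJ.
- by move=> th _; rewrite lee_fin mulr_ge0.
exists (~` K); split => //; first exact: measurableC.
move=> th /= nle Kth; apply: nle => _.
rewrite !mixF_in// -(EkD_int (Ih2 Kth) (Ih1 Kth)).
have -> : (fun t => h2 t + h1 (th, t)) = log_excess th.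
  by apply/funext => t; rewrite addrC h1D2.
by case: (log_excess_bound Kth).
Qed.

End fixed_horizon.

(** * Convergence *)

Lemma near_addl (N : nat) (P : nat -> Prop) :
  (\forall k \near \oo, P k) -> \forall M \near \oo, P (N + M)%N.
Proof.
move=> [n0 _ h]; exists n0 => // M /= nM; apply: h => /=.
exact: leq_trans nM (leq_addl _ _).
Qed.

Lemma sup_cvg0_nonempty (R : realType) (I : Type) (F : nat -> I -> \bar R) (A : set I) :
  (fun k => ereal_sup [set F k i | i in A]) @ \oo --> 0%E -> A !=set0.
Proof.
move=> h; apply/set0P/eqP => A0.
have /h[n _ /(_ n (leqnn _))] : nbhs (0 : \bar R) [set y | (-1%E < y)%E].
  by apply: open_nbhs_nbhs; split; [exact: open_ereal_gt_ereal|rewrite /= lte_fin ltrN10].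
by rewrite /= A0 image_set0 ereal_sup0.
Qed.

(** This supplies a member of [PK K], so that the supremum in the conclusion is not taken over the
    empty set. *)
Lemma PK_dirac (R : realType) (n : nat) (K : set 'rV[R]_n) (th : 'rV[R]_n) :
  compact K -> K th -> PK K (\d_(th : Par R n) : probability (Par R n) R).
Proof.
move=> cK Kth th' supp; apply: contrapT => Kth'.
have oKC : open (~` K).
  by apply: closed_openC; apply: compact_closed => //; exact: norm_hausdorff.
have := supp _ oKC Kth'; rewrite /= diracE memNset ?ltxx//.
Qed.

(** * Smallness of the upper bound on the block gain *)

Section EU.
Context (R : realType) (dim : nat) (d : measure_display) (X : measurableType d).
Variables (mu : {sigma_finite_measure set X -> \bar R})
  (muk : forall k, {measure set (k.-tuple X) -> \bar R})
  (p : X -> 'rV[R]_dim -> R) (K : set 'rV[R]_dim)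
  (thetah : forall k, k.-tuple X -> 'rV[R]_dim) (delta : R) (L T : X -> R).
Arguments thetah : clear implicits.
Hypothesis muP : is_product_measure mu muk.
Hypothesis mp : measurable_fun setT (fun w : X * Par R dim => p w.1 w.2).
Hypothesis mth : forall k, measurable_fun setT (thetah k : k.-tuple X -> Par R dim).
Hypothesis Kp : forall th, K th -> forall z, 0 < p z th.
Hypothesis K1 : forall th, K th -> (\int[mu]_z (p z th)%:E = 1)%E.
Hypothesis delta0 : 0 < delta.
Hypothesis L0 : forall z, 0 <= L z.
Hypothesis mL : measurable_fun setT L.
Hypothesis T0 : forall z, 0 <= T z.
Hypothesis mT : measurable_fun setT T.
Variables (N : nat) (S : R).
Hypothesis S0 : 0 <= S.
Hypothesis ELS : forall th, K th -> (\int[mu]_z (p z th * L z)%:E <= S%:E)%E.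
Hypothesis tL : tail muk p K thetah L.
Hypothesis tT : tail muk p K thetah T.

(** The order of choices matters: [eta] is fixed first, so that the [N] near terms cost at most
    [e / 2]; only then is [M] taken so large that each far expectation is at most [t], a level at
    which the [N] far terms cost the other half. *)
Lemma block_gain_ub_near (e : R) : 0 < e -> exists eta : R, [/\ 0 < eta, eta <= delta &
  \forall M \near \oo, forall th, K th ->
    (Ek muk p th (@block_gain_ub _ _ _ X thetah delta L T N M eta th) <= e%:E)%E].
Proof.
move=> e0; pose eta := Num.min delta (e / 2 / (N%:R * S + 1)).
have NS : 0 < N%:R * S + 1 by rewrite ltr_wpDl// mulr_ge0.
have eta0 : 0 < eta by rewrite lt_min delta0 divr_gt0// divr_gt0.
pose t := e / 2 / ((delta + 1) * (N%:R + 1)).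
have dN : 0 < (delta + 1) * (N%:R + 1) by rewrite mulr_gt0// ?addr_gt0// ltr_wpDl.
have t0 : 0 < t by rewrite divr_gt0// divr_gt0.
exists eta; split; [exact: eta0|by rewrite ge_min lexx|].
have := near_addl N (tL eta0 t0); have := near_addl N (tT eta0 t0).
apply: filterS2 => M hT hL th Kth; have pth := Kp Kth.
have mc (f : X -> R) i : measurable_fun setT f ->
    measurable_fun setT (fun t : (N + M).-tuple X => f (tnth t i)).
  by move=> mf; apply: (measurableT_comp mf); exact: measurable_tnth.
have mfar := @measurable_far _ _ _ _ thetah mth (N + M)%N th eta.
have mf1 (f : X -> R) i : measurable_fun setT f ->
    measurable_fun setT (fun t : (N + M).-tuple X => f (tnth t i) * far thetah th eta t).
  by move=> mf; apply: measurable_funM => //; exact: mc.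
have ge1 (f : X -> R) i : (forall z, 0 <= f z) -> forall t : (N + M).-tuple X,
    0 <= f (tnth t i) * far thetah th eta t.
  by move=> f0 t'; rewrite mulr_ge0// far_ge0.
rewrite /block_gain_ub (Ek_sum muk mp pth (f := fun i t => eta * L (tnth t (lshift M i)) +
    (delta * (L (tnth t (lshift M i)) * far thetah th eta t) +
     T (tnth t (lshift M i)) * far thetah th eta t))); last 2 first.
- move=> i; apply: measurable_funD; first by apply: measurable_funM => //; exact: mc.
  by apply: measurable_funD; [apply: measurable_funM => //; exact: mf1|exact: mf1].
- move=> i t'; rewrite addr_ge0 ?mulr_ge0//; first exact: ltW.
  by rewrite addr_ge0 ?ge1// mulr_ge0 ?ge1// ltW.
apply: (@le_trans _ _ (\sum_(i < N) (eta * S + (delta * t + t))%:E)%E).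
  apply: lee_sum => i _.
  rewrite (EkD muk mp pth (f := fun t => eta * L (tnth t (lshift M i)))); last 4 first.
  - by apply: measurable_funM => //; exact: mc.
  - by apply: measurable_funD; [apply: measurable_funM => //; exact: mf1|exact: mf1].
  - by move=> t'; rewrite mulr_ge0// ltW.
  - by move=> t'; rewrite addr_ge0 ?ge1// mulr_ge0 ?ge1// ltW.
  rewrite (EkD muk mp pth
    (f := fun t => delta * (L (tnth t (lshift M i)) * far thetah th eta t))); last 4 first.
  - by apply: measurable_funM => //; exact: mf1.
  - exact: mf1.
  - by move=> t'; rewrite mulr_ge0 ?ge1// ltW.
  - exact: ge1.
  rewrite (EkZ muk mp pth (mc _ _ mL))//; last exact: ltW.
  rewrite (EkZ muk mp pth (mf1 _ _ mL) (ge1 _ _ L0)); last exact: ltW.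
  rewrite (Ek_coord muP mp pth (K1 Kth) (lshift M i) mL L0).
  rewrite !EFinD !EFinM; apply: leeD; last apply: leeD.
  - by apply: lee_wpmul2l; [rewrite lee_fin ltW|exact: ELS].
  - by apply: lee_wpmul2l; [rewrite lee_fin ltW|exact: hL].
  - exact: hT.
rewrite sumEFin sumr_const card_ord lee_fin -mulr_natl mulrDr [leRHS]splitr.
apply: lerD.
  apply: (@le_trans _ _ ((e / 2 / (N%:R * S + 1)) * (N%:R * S))).
    by rewrite mulrCA ler_wpM2r ?mulr_ge0// ge_min lexx orbT.
  by rewrite -mulrA ler_piMr ?divr_ge0 ?ltW// mulrC ltr_pdivrMr// mul1r ltrDl.
have -> : N%:R * (delta * t + t) = t * ((delta + 1) * N%:R) by ring.
rewrite /t -mulrA ler_piMr ?divr_ge0 ?ltW//.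
rewrite mulrC ltr_pdivrMr// mul1r ltr_pM2l ?addr_gt0//.
by rewrite ltrDl.
Qed.

End EU.
Unset Implicit Arguments.

Theorem theorem1 (R : realType) (dim : nat)
  (d : measure_display) (X : measurableType d)
  (mu : {sigma_finite_measure set X -> \bar R})
  (muk : forall k, {measure set (k.-tuple X) -> \bar R})
  (Theta : set 'rV[R]_dim) (p : X -> 'rV[R]_dim -> R)
  (thetah : forall k, k.-tuple X -> 'rV[R]_dim)
  (K : set 'rV[R]_dim) (delta : R) (N : nat)
  (L T : X -> R) (alpha beta r : \bar R) (C : nat -> R) :
  (* mu^k is the k-fold product of mu *)
  is_product_measure mu muk ->
  (* p(.|theta) is a probability density w.r.t. mu for theta in Theta *)
  (forall th, Theta th ->
     (forall z, 0 <= p z th) /\ (\int[mu]_z (p z th)%:E = 1)%E) ->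
  (* (implicit) measurability of the model and of the estimator *)
  measurable_fun setT (fun w : X * Par R dim => p w.1 w.2) ->
  (forall k, measurable_fun setT (thetah k : k.-tuple X -> Par R dim)) ->
  (* thetah is a maximum likelihood estimator *)
  (forall k (z : k.-tuple X), Theta (thetah k z) /\
     forall th, Theta th -> pk p k z th <= pk p k z (thetah k z)) ->
  (* K, delta *)
  compact K -> K `<=` Theta° ->
  (forall z th, K th -> 0 < p z th) ->
  0 < delta -> Kdelta Theta K delta `<=` Theta° ->
  (* (A1) *)
  measurable_fun setT L -> (forall z, 0 <= L z) -> (1 <= alpha)%E ->
  (forall z th1 th2, Kdelta Theta K delta th1 -> Kdelta Theta K delta th2 ->
     0 < p z th1 /\ 0 < p z th2 /\
     `|ln (p z th1) - ln (p z th2)| <= L z * enorm (th1 - th2)) ->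
  (match alpha with
   | a%:E => (ereal_sup [set (\int[mu]_z (p z th * L z `^ a)%:E)%E | th in K]
                < +oo)%E
   | _ => (ess_sup mu (EFin \o L) < +oo)%E
   end) ->
  (* (A2) *)
  conj_exp alpha beta ->
  (match beta with
   | b%:E => (fun k => ereal_sup [set (\int[muk k]_z
                 (pk p k z th * enorm (thetah k z - th) `^ b)%:E)%E | th in K])
             @ \oo --> 0%E
   | _ => (fun k => ereal_sup [set ess_sup (muk k)
                 (fun z => (enorm (thetah k z - th))%:E) | th in K])
          @ \oo --> 0%E
   end) ->
  (* (A3) *)
  measurable_fun setT T -> (forall z, 0 <= T z) -> (1 < r)%E ->
  (forall z th, K th ->
     ln (p z (thetah 1%N [tuple z])) - ln (p z th) <= T z) ->
  (match r with
   | r'%:E => (ereal_sup [set (\int[mu]_z (p z th * T z `^ r')%:E)%E | th in K]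
                < +oo)%E
   | _ => (ess_sup mu (EFin \o T) < +oo)%E
   end) ->
  (* (A4) *)
  (fun k => ereal_sup [set (`| \int[muk k]_z
       ((pk p k z th)%:E * lne ((pk p k z (thetah k z))%:E * ((pk p k z th)%:E)^-1))
       - (dim%:R / 2)%:E |)%E | th in K]) @ \oo --> 0%E ->
  (* (A5), for the fixed N, with constants C M = C^{N,M} *)
  (fun M => ereal_sup [set (`| \int[muk N]_x
       ((pk p N x th)%:E * lne (Zcnml3 p muk thetah N M x))
       - (C M)%:E |)%E | th in K]) @ \oo --> 0%E ->
  (* conclusion, with tilde C^{N,M} = C^{N,M} - d/2 *)
  (fun M => ereal_sup [set (`| Dq p muk N M (qcnml3 p muk thetah N M) pi
       + RKLpi p muk N M pi - (C M - dim%:R / 2)%:E |)%E | pi in PK K])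
    @ \oo --> 0%E.
Proof.
move=> muP dens mp mth mle cK KTi Kp delta0 _ mL L0 a1 lip aL ab A2 mT T0 r1 HT rT A4 A5.
(* If [K] were empty, the suprema in (A4) would be [-oo]. *)
have K0 : K !=set0 := sup_cvg0_nonempty A4.
have KT : K `<=` Theta by move=> th /KTi/interior_subset.
have p_ge0 th : Theta th -> forall z, 0 <= p z th by move=> /dens[].
have K1 th : K th -> (\int[mu]_z (p z th)%:E = 1)%E by move=> /KT/dens[].
have Kp' th : K th -> forall z, 0 < p z th by move=> Kth z; exact: Kp.
have Tm : exists2 s, 1 < s & exists2 S, 0 <= S & moment_le mu p K T s S.
  case: r r1 rT => [r' r1 rT|_ rT|//].
    by exists r'; [rewrite -lte_fin|exact: moment_ereal_sup].
  by exists 2; [rewrite ltr1n|exact: moment_ess_sup].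
have [sT sT1 [ST ST0 TS]] := Tm.
have A2tail (b s S : R) (f : X -> R) : 0 < b ->
    ((fun k => ereal_sup [set (\int[muk k]_z
       (pk p k z th * enorm (thetah k z - th) `^ b)%:E)%E | th in K]) @ \oo --> 0%E) ->
    measurable_fun setT f -> (forall z, 0 <= f z) -> 1 < s -> 0 <= S ->
    moment_le mu p K f s S -> tail muk p K thetah f.
  move=> b0 Eb mf f0 s1 S0 fS.
  apply: (tail_moment muP mp mth Kp' K1 mf f0 s1 S0 fS b0).
  exact: (sup_cvg0_near Eb).
have [[SL SL0 LS] [tL tT]] : (exists2 S, 0 <= S &
    forall th, K th -> (\int[mu]_z (p z th * L z)%:E <= S%:E)%E) /\
    tail muk p K thetah L /\ tail muk p K thetah T.
  (* For [alpha = +oo] conjugacy gives [beta = 1], and [L] has a second moment; for [beta = +oo]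
     both tails vanish eventually; otherwise both exponents are finite, and [1 < a] and [0 < b] have
     to be extracted before [tail_moment] applies. *)
  case: alpha a1 aL ab => [a a1 aL|_ aL|//]; last first.
    have [S S0 LS] := moment_ess_sup mp Kp' K1 mL L0 aL.
    case: beta A2 => [b|//|//] A2 /= b1; rewrite b1 in A2.
    have two1 : 1 < 2 :> R by rewrite ltr1n.
    split; last by split; [exact: (A2tail _ _ _ _ ltr01 A2 mL L0 two1 S0 LS)|
      exact: (A2tail _ _ _ _ ltr01 A2 mT T0 sT1 ST0 TS)].
    exists (1 + S); first by rewrite addr_ge0.
    by apply: (moment_first mp Kp' K1 mL L0 _ LS); rewrite ler1n.
  rewrite lee_fin in a1.
  have [S S0 LS] := moment_ereal_sup aL.
  move=> ab; split.
    exists (1 + S); first by rewrite addr_ge0.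
    exact: (moment_first mp Kp' K1 mL L0 a1 LS).
  case: beta A2 ab => [b|/=|//] A2 /= ab; last first.
    have A2' := sup_cvg0_near A2.
    by split; apply: (tail_ess_sup mp mth).
  (* [conj_exp 1 0] holds since [0^-1 = 0], but then the integrals in (A2) are 1. *)
  have b0 : b != 0.
    apply/eqP => b0; have [th Kth] := K0.
    have [n _ /(_ n (leqnn _))/(_ _ Kth)] := sup_cvg0_near A2 (e := 2^-1) ltac:(by []).
    have -> : (\int[muk n]_z (pk p n z th * enorm (thetah n z - th) `^ b)%:E)%E = 1%E.
      rewrite -(integral_pk muP mp (Kp' _ Kth) (K1 _ Kth) n).
      by apply: eq_integral => t _; rewrite b0 powRr0 mulr1.
    rewrite lee_fin.
    by rewrite leNgt invf_lt1 ?ltr1n.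
  have {}a1 : 1 < a.
    rewrite lt_neqAle a1 andbT; apply/eqP => aE; move: ab; rewrite -aE invr1.
    by move/eqP; rewrite -subr_eq0 addrAC subrr add0r invr_eq0 (negPf b0).
  have {}b0 : 0 < b.
    rewrite -invr_gt0; have -> : b^-1 = 1 - a^-1 by rewrite -ab addrC addKr.
    by rewrite subr_gt0 invf_lt1// (lt_trans ltr01).
  by split; [exact: (A2tail _ _ _ _ b0 A2 mL L0 a1 S0 LS)|
    exact: (A2tail _ _ _ _ b0 A2 mT T0 sT1 ST0 TS)].
pose S := SL + (1 + ST).
have S0 : 0 <= S by rewrite !addr_ge0.
have ELS th : K th -> (\int[mu]_z (p z th * L z)%:E <= S%:E)%E.
  by move=> Kth; apply: (le_trans (LS _ Kth)); rewrite lee_fin lerDl addr_ge0.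
have ETS th : K th -> (\int[mu]_z (p z th * T z)%:E <= S%:E)%E.
  move=> Kth; apply: (le_trans (moment_first mp Kp' K1 mT T0 (ltW sT1) TS Kth)).
  by rewrite lee_fin lerDr.
have [D D0 KD] := compact_diam cK.
apply: near_sup_cvg0 => [|k pi|e e0].
- by have [th Kth] := K0; exists (\d_(th : Par R dim)); exact: PK_dirac.
- exact: abse_ge0.
have e40 : 0 < e / 4 by rewrite divr_gt0.
have [eta [eta0 etad EU]] := block_gain_ub_near muP mp mth Kp' K1 delta0 L0 mL T0 mT N S0 ELS tL tT e40.
have A4' : \forall k \near \oo, forall th, K th ->
    (`|Ek muk p th (mle_gap p thetah th (k := k)) - (dim%:R / 2)%:E| <= (e / 4)%:E)%E.
  apply: filterS (sup_cvg0_near A4 e40) => k hk th Kth.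
  apply: le_trans (hk _ Kth); rewrite le_eqVlt; apply/orP; left; apply/eqP.
  congr (`|_ - _|)%E; apply: eq_integral => t _.
  by rewrite lne_ratio ?(pk_mle_gt0 mle KT Kp' K0) ?pk_gt0//; exact: Kp'.
have A5' := sup_cvg0_near A5 e40.
near=> M => pi piK.
have [mK piK0] := measure_msupport_setC cK piK.
have -> : e%:E = (4 * (e / 4))%:E by rewrite mulrC divfK.
apply: (Dq_RKLpi_bound muP mp mth p_ge0 mle KT Kp' K1 K0 delta0 L0 mL T0 mT lip HT
  S0 (ltW e40) (ltW eta0) etad ELS ETS _ _ _ D0 mK piK0 KD).
- move=> k [->|->] th Kth; move: th Kth; near: M; last exact: A4'.
  exact: (near_addl N A4').
- by near: M.
- by near: M.
Unshelve. all: by end_near. Qed.
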